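(* Let $\mathbb A$ be the 3D cyclic algebra, let $k\in\mathbb A=\mathbb R^3$ be a constant vector, and let $\varphi:\mathbb R^3\to\mathbb A$ be the affine map $\varphi(q)=Aq+k$, where $$A=\begin{pmatrix}-1&-1&0\\ 1&0&-1\\ 0&1&1\end{pmatrix}.$$ Let $\mathcal U\subset\mathbb R^3$ be open and let $\mathbf F=F^1e+F^2e_2+F^3e_3:\mathcal U\to\mathbb A$ be a $\varphi\mathbb A$-differentiable vector field, satisfying the Cauchy-Riemann equations $$\begin{aligned} F^1_x-F^1_y-F^2_x+F^3_y&=0,\\ -F^1_x+F^2_y+F^3_x-F^3_y&=0,\\ -F^1_z-F^2_x+F^3_x+F^3_z&=0,\\ F^1_x+F^1_z-F^2_z-F^3_x&=0 \end{aligned}$$ on $\mathcal U$. Then the vector field $\mathbf V:\mathcal U\to\mathbb A$ defined by $$\mathbf V=V(\mathbf F)=(F^3-F^2)e_1+(F^3-F^1)e_2+(F^2-F^1)e_3,$$ which takes values in $V(\Pi)$, satisfies $$\mathrm{div}\,\mathbf V=0,\qquad \mathrm{curl}\,\mathbf V=\mathbf 0.$$ Moreover, $\mathbf V$ is also harmonic: $\Delta\mathbf V=\mathbf 0$.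
   Context: The 3D cyclic algebra $\mathbb A$ is $\mathbb R^3$ with canonical basis $e=e_1,e_2,e_3$ and the bilinear, commutative, associative product $\ast$ with identity $e$ determined by $e_2\ast e_2=e_3$, $e_2\ast e_3=e$, $e_3\ast e_3=e_2$. Coordinates on $\mathbb R^3$ are $(x,y,z)$; subscripts $x,y,z$ denote partial derivatives; div, curl and $\Delta$ (acting componentwise) are the usual Euclidean operators on $\mathbb R^3$, with vector fields having components with respect to $e_1,e_2,e_3$. $\varphi\mathbb A$-differentiability: given $\varphi:\mathcal U\subset\mathbb R^3\to\mathbb A$ differentiable in the usual sense, a map $\mathbf F:\mathcal U\to\mathbb A$ is $\varphi\mathbb A$-differentiable if $\mathbf F$ is differentiable in the usual sense and there exists a map $\mathbf F'_\varphi:\mathcal U\to\mathbb A$ such that $d\mathbf F_q(v)=\mathbf F'_\varphi(q)\ast d\varphi_q(v)$ for all $q\in\mathcal U$ and $v\in\mathbb R^3$. $\Pi=\{xe+ye_2+ze_3: x+y+z=0\}$ (the nodal plane), and $V:\mathbb A\to\mathbb A$ is the linear map $V(\upsilon)=(\upsilon^3-\upsilon^2)e_1+(\upsilon^3-\upsilon^1)e_2+(\upsilon^2-\upsilon^1)e_3$ for $\upsilon=\upsilon^1e_1+\upsilon^2e_2+\upsilon^3e_3$. *)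

(* Defs.v *)
From HB Require Import structures.
From mathcomp Require Import all_boot all_order all_algebra.
From mathcomp Require Import all_classical all_reals all_analysis.

Set Implicit Arguments.
Unset Strict Implicit.
Unset Printing Implicit Defensive.

Import Order.TTheory GRing.Theory Num.Theory.
Import numFieldNormedType.Exports.

Local Open Scope classical_set_scope.
Local Open Scope ring_scope.

(* Both the Euclidean space R^3 and the algebra A are 'cV[R]_3.  Indices live
   in 'I_3, so the canonical basis e_1, e_2, e_3 is [basis 0, 1, 2] and
   addition of indices is modulo 3. *)

Definition basis (R : realType) (i : 'I_3) : 'cV[R]_3 := delta_mx i 0.

Definition col3 (R : realType) (a b c : R) : 'cV[R]_3 :=
  \col_(i < 3) nth 0 [:: a; b; c] i.

(* The table e_2 * e_2 = e_3, e_2 * e_3 = e_1, e_3 * e_3 = e_2 with unit e_1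
   is basis i * basis j = basis (i + j) (see [cyc_mul_basis]), so the bilinear
   product it determines is a convolution over Z/3. *)
Definition cyc_mul (R : realType) (u v : 'cV[R]_3) : 'cV[R]_3 :=
  \col_k \sum_(i < 3) u i 0 * v (k - i) 0.

Lemma cyc_mul_basis (R : realType) (i j : 'I_3) :
  cyc_mul (basis R i) (basis R j) = basis R (i + j).
Proof.
apply/matrixP => k l; rewrite !mxE (bigD1 i)//= big1 => [|h hi].
  rewrite !mxE eqxx mul1r addr0 !ord1 !eqxx !andbT; congr (_%:R).
  by rewrite subr_eq addrC.
by rewrite !mxE (negbTE hi) mul0r.
Qed.

Lemma cyc_mulDl (R : realType) (a : R) (u v w : 'cV[R]_3) :
  cyc_mul (a *: u + v) w = a *: cyc_mul u w + cyc_mul v w.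
Proof.
apply/matrixP => k l; rewrite !mxE mulr_sumr -big_split/=.
by apply: eq_bigr => i _; rewrite !mxE mulrDl mulrA.
Qed.

Lemma cyc_mulC (R : realType) (u v : 'cV[R]_3) : cyc_mul u v = cyc_mul v u.
Proof.
apply/matrixP => k l; rewrite !mxE (reindex_inj (subrI k))/=.
by apply: eq_bigr => i _; rewrite subKr mulrC.
Qed.

Lemma cyc_mulA (R : realType) (u v w : 'cV[R]_3) :
  cyc_mul u (cyc_mul v w) = cyc_mul (cyc_mul u v) w.
Proof.
apply/matrixP => k l; rewrite !mxE.
under eq_bigr do rewrite mxE mulr_sumr.
under [RHS]eq_bigr do rewrite mxE mulr_suml.
rewrite [RHS]exchange_big/=; apply: eq_bigr => i _.
rewrite [RHS](reindex_inj (addIr i))/=; apply: eq_bigr => j _.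
by rewrite addrK mulrA opprD addrA (addrAC k).
Qed.

Lemma cyc_mul1 (R : realType) (u : 'cV[R]_3) : cyc_mul (basis R 0) u = u.
Proof.
apply/matrixP => k l; rewrite !mxE (bigD1 0)//= big1 => [|i i0].
  by rewrite !mxE !eqxx mul1r addr0 subr0 ord1.
by rewrite !mxE (negbTE i0) mul0r.
Qed.

(* As for every function below, [F] is total but only its values on the open
   set [U] matter. *)
Definition phiA_differentiable (R : realType) (U : set 'cV[R]_3)
    (phi F : 'cV[R]_3 -> 'cV[R]_3) : Prop :=
  (forall q, U q -> differentiable phi q) /\
  (forall q, U q -> differentiable F q) /\
  exists F' : 'cV[R]_3 -> 'cV[R]_3,
    forall q v, U q -> 'd F q v = cyc_mul (F' q) ('d phi q v).

Definition component (R : realType) (F : 'cV[R]_3 -> 'cV[R]_3) (i : 'I_3) :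
  'cV[R]_3 -> R := fun q => F q i 0.

Definition partial (R : realType) (i : 'I_3) (f : 'cV[R]_3 -> R) :
  'cV[R]_3 -> R := 'D_(basis R i) f.

Definition dx (R : realType) := @partial R 0.
Definition dy (R : realType) := @partial R 1.
Definition dz (R : realType) := @partial R 2.

Definition div3 (R : realType) (F : 'cV[R]_3 -> 'cV[R]_3) (q : 'cV[R]_3) : R :=
  dx (component F 0) q + dy (component F 1) q + dz (component F 2) q.

Definition curl3 (R : realType) (F : 'cV[R]_3 -> 'cV[R]_3) (q : 'cV[R]_3) :
    'cV[R]_3 :=
  col3 (dy (component F 2) q - dz (component F 1) q)
       (dz (component F 0) q - dx (component F 2) q)
       (dx (component F 1) q - dy (component F 0) q).

Definition laplacian (R : realType) (f : 'cV[R]_3 -> R) (q : 'cV[R]_3) : R :=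
  dx (dx f) q + dy (dy f) q + dz (dz f) q.

Definition vlaplacian (R : realType) (F : 'cV[R]_3 -> 'cV[R]_3)
    (q : 'cV[R]_3) : 'cV[R]_3 :=
  \col_i laplacian (component F i) q.

Definition C1_on (R : realType) (U : set 'cV[R]_3) (f : 'cV[R]_3 -> R) : Prop :=
  forall i q, U q ->
    derivable f q (basis R i) /\ {for q, continuous (partial i f)}.

Definition C2_on (R : realType) (U : set 'cV[R]_3) (f : 'cV[R]_3 -> R) : Prop :=
  C1_on U f /\ forall i, C1_on U (partial i f).

(* Since 'D_v f q has a default value when the limit does not exist, a
   vanishing [vlaplacian] is meaningful only together with the regularity
   clause. *)
Definition harmonic_field (R : realType) (U : set 'cV[R]_3)
    (F : 'cV[R]_3 -> 'cV[R]_3) : Prop :=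
  (forall i, C2_on U (component F i)) /\ (forall q, U q -> vlaplacian F q = 0).

Definition matA (R : realType) : 'M[R]_3 :=
  \matrix_(i < 3, j < 3)
    nth 0 (nth [::] [:: [:: -1; -1;  0];
                        [::  1;  0; -1];
                        [::  0;  1;  1]] i) j.

Definition nodal_plane (R : realType) : set 'cV[R]_3 :=
  [set u | u 0 0 + u 1 0 + u 2 0 = 0].

Definition Vmap (R : realType) (u : 'cV[R]_3) : 'cV[R]_3 :=
  col3 (u 2 0 - u 1 0) (u 2 0 - u 0 0) (u 1 0 - u 0 0).

(* Main.v *)
(* By its linear part, [phi] maps R^3 onto the nodal plane, which is the
   complex factor of A = R[Z/3] = R x C.  Hence the image [p + i q] of [F] in
   that factor is holomorphic in a complex coordinate [alpha + i beta], where
   the linear forms [alpha] and [beta] are orthogonal and of equal norm, and the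
   components of [V] are linear combinations of [p] and [q].  The only
   difficulty is regularity, since [F] is merely differentiable.  It comes from
   Goursat's bisection argument, applied in the coordinate [log w] to the closed
   form [Im ((f / w) d(log w))] with [f = p + i q]: the mean of [Re (f / w)] over
   a circle does not depend on the radius, which bounds the derivative of [f] at
   the centre by the supremum of [f].  Applied to difference quotients, this
   Cauchy estimate shows that the derivative is again holomorphic. *)
From HB Require Import structures.
Require Import Defs.
From mathcomp Require Import all_boot all_order all_algebra.
From mathcomp Require Import all_classical all_reals all_analysis.
From mathcomp Require Import ring lra.
Set Implicit Arguments.
Unset Strict Implicit.
Unset Printing Implicit Defensive.

Import Order.TTheory GRing.Theory Num.Theory.
Import numFieldNormedType.Exports.
Local Open Scope classical_set_scope.
Local Open Scope ring_scope.

(** * Goursat's theorem on rectangles *)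

Lemma mvt_bound (R : realType) (f df : R -> R) (a b K : R) :
  a <= b ->
  (forall x, a <= x <= b -> is_derive x 1 f (df x)) ->
  (forall x, a <= x <= b -> `|df x| <= K) ->
  `|f b - f a| <= K * (b - a).
Proof.
move=> ab fdf dfK.
have [x xab| |c cab ->] := @MVT_segment R f df a b ab.
- by apply: fdf; move: xab; rewrite in_itv/= => /andP[/ltW -> /ltW ->].
- apply: derivable_within_continuous => x; rewrite in_itv/= => xab.
  by have [] := fdf x xab.
rewrite normrM [X in _ * X]ger0_norm ?subr_ge0//.
by rewrite ler_wpM2r ?subr_ge0// dfK// -in_itv.
Qed.

Lemma continuous_primitive (R : realType) (f : R -> R) (a b : R) :
  (forall x, a <= x <= b -> {for x, continuous f}) ->
  exists G : R -> R, forall x, a < x < b -> is_derive x 1 G (f x).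
Proof.
move=> cf; exists (fun x => \int[lebesgue_measure]_(t in `[a, x]) f t)%R.
move=> x /andP[ax xb].
have intf : lebesgue_measure.-integrable `[a, b] (EFin \o f).
  apply: continuous_compact_integrable; first exact: segment_compact.
  apply: (@continuous_in_subspaceT R R) => y; rewrite inE/= in_itv/=.
  exact: cf.
have cfx : {for x, continuous f} by apply: cf; rewrite (ltW ax) (ltW xb).
have [dG G'] := continuous_FTC1_closed xb intf ax cfx.
rewrite derive1E in G'; exact: DeriveDef dG G'.
Qed.

(** The mixed second difference of [H], additive when a rectangle is cut into smaller ones. If each
    [H s] is a primitive of some [f s], it is the integral of [f s' - f s] over [[t, t']]. *)
Definition rect_incr (R : realType) (H : R -> R -> R) (s s' t t' : R) : R :=
  H s' t' - H s' t - H s t' + H s t.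

Lemma natr_lt_exp2 (R : realType) (n : nat) : n%:R < 2 ^+ n :> R.
Proof. by rewrite -natrX ltr_nat ltn_expl. Qed.

(** Goursat's bisection: one of the four quarters of a rectangle carries at least a quarter of its
    increment, so [m / 4 ^ n] survives [n] cuts. The rectangles shrink to a point, where the local
    bound by a small multiple of the squared size contradicts this. *)
Lemma rect_incr_eq0 (R : realType) (H : R -> R -> R) (a b c d : R) :
  a <= b -> c <= d ->
  (forall s0 t0 e, a <= s0 <= b -> c <= t0 <= d -> 0 < e ->
    exists2 r, 0 < r & forall s s' t t',
      [/\ a <= s, s <= s0, s0 <= s' & s' <= b] ->
      [/\ c <= t, t <= t0, t0 <= t' & t' <= d] ->
      s' - s <= r -> t' - t <= r ->
      `|rect_incr H s s' t t'| <= e * ((s' - s) + (t' - t)) ^+ 2) ->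
  rect_incr H a b c d = 0.
Proof.
move=> ab cd Hloc; apply/eqP/negPn/negP => H0.
set m := `|rect_incr H a b c d|.
have m0 : 0 < m by rewrite normr_gt0.
pose A := b - a; pose B := d - c.
have A0 : 0 <= A by rewrite subr_ge0.
have B0 : 0 <= B by rewrite subr_ge0.
pose h n : R := (2 ^+ n)^-1.
have h0 n : 0 < h n by rewrite invr_gt0 exprn_gt0.
have hS n : h n = h n.+1 + h n.+1.
  by rewrite /h exprS; field; rewrite expf_neq0.
(* [u] is the lower left corner of a rectangle with sides [A * h n] and [B * h n]. *)
pose inv (n : nat) (u : R * R) :=
  [/\ a <= u.1, u.1 + A * h n <= b, c <= u.2, u.2 + B * h n <= d
    & m * h n ^+ 2 <=
      `|rect_incr H u.1 (u.1 + A * h n) u.2 (u.2 + B * h n)|].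
pose rel (n : nat) (u v : R * R) :=
  [/\ u.1 <= v.1, v.1 + A * h n.+1 <= u.1 + A * h n, u.2 <= v.2
    & v.2 + B * h n.+1 <= u.2 + B * h n].
have step n u : inv n u -> exists2 v, inv n.+1 v & rel n u v.
  case: u => s t [/= as_ sb ct td mh].
  set k := A * h n.+1; set l := B * h n.+1.
  have k0 : 0 <= k by rewrite mulr_ge0// ltW.
  have l0 : 0 <= l by rewrite mulr_ge0// ltW.
  have kE : A * h n = k + k by rewrite hS mulrDr.
  have lE : B * h n = l + l by rewrite hS mulrDr.
  have mE : m * h n ^+ 2 = m * h n.+1 ^+ 2 *+ 4 by rewrite (hS n); ring.
  rewrite kE in sb mh; rewrite lE in td mh; rewrite mE in mh.
  pose bad i j :=
    m * h n.+1 ^+ 2 <= `|rect_incr H (s + i) (s + i + k) (t + j) (t + j + l)|.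
  suff [[i j] [/= ik jl]] : exists ij : R * R,
      [/\ 0 <= ij.1 <= k, 0 <= ij.2 <= l & bad ij.1 ij.2].
    move=> bij; exists (s + i, t + j); split; rewrite /= -/k -/l ?kE ?lE//; clear -as_ sb ct td ik jl; lra.
  have [b00|b00] := boolP (bad 0 0).
    by exists (0, 0); split; rewrite /= ?lexx ?k0 ?l0.
  have [b01|b01] := boolP (bad 0 l).
    by exists (0, l); split; rewrite /= ?lexx ?k0 ?l0.
  have [b10|b10] := boolP (bad k 0).
    by exists (k, 0); split; rewrite /= ?lexx ?k0 ?l0.
  have [b11|b11] := boolP (bad k l).
    by exists (k, l); split; rewrite /= ?lexx ?k0 ?l0.
  (* If all four quarters fell short of the bound, additivity would make the whole rectangle fall
     short too. *)
  exfalso; move: b00 b01 b10 b11 mh; rewrite /bad -!ltNge !addr0.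
  set x1 := rect_incr _ _ _ _ _; set x2 := rect_incr _ _ _ _ _.
  set x3 := rect_incr _ _ _ _ _; set x4 := rect_incr _ _ _ _ _.
  have -> : rect_incr H s (s + (k + k)) t (t + (l + l)) = x1 + x2 + (x3 + x4).
    by rewrite /x1 /x2 /x3 /x4 /rect_incr !addrA; ring.
  have := ler_normD (x1 + x2) (x3 + x4).
  have := ler_normD x1 x2; have := ler_normD x3 x4.
  by move: (m * _) => M; lra.
(* Dependent choice iterates a relation on a fixed type, so the level [n] is part of the state; a
   state violating [inv] is sent to itself. *)
have [g [g0 gS]] : exists g : nat -> nat * (R * R), g 0%N = (0%N, (a, c)) /\
    forall n, inv (g n).1 (g n).2 ->
      [/\ (g n.+1).1 = (g n).1.+1, inv (g n.+1).1 (g n.+1).2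
        & rel (g n).1 (g n).2 (g n.+1).2].
  have next (x : nat * (R * R)) : {y : nat * (R * R) | inv x.1 x.2 ->
      [/\ y.1 = x.1.+1, inv y.1 y.2 & rel x.1 x.2 y.2]}.
    apply: cid; case: (pselect (inv x.1 x.2)) => [/step[v iv rv]|nix].
      by exists (x.1.+1, v).
    by exists x => /nix.
  by have [g [g0 gS]] := dependent_choice next (0%N, (a, c)); exists g.
have ginv n : (g n).1 = n /\ inv n (g n).2.
  elim: n => [|n [gn1 ign]].
    rewrite g0; split=> //; rewrite /inv/= /h expr0 invr1 !mulr1 expr1n mulr1.
    rewrite /A /B.
    have -> : a + (b - a) = b by ring.
    by have -> : c + (d - c) = d by ring.
  have := gS n; rewrite gn1 => /(_ ign)[g1 ig _].
  by rewrite g1 in ig *.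
have grel n : rel n (g n).2 (g n.+1).2.
  by have [gn1 ign] := ginv n; have := gS n; rewrite gn1 => /(_ ign)[].
pose s n := (g n).2.1; pose t n := (g n).2.2.
(* Nested intervals: the supremum of the left ends lies below every right end. *)
have nest (x : nat -> R) C : 0 <= C ->
    (forall n, x n <= x n.+1 /\ x n.+1 + C * h n.+1 <= x n + C * h n) ->
    exists x0, forall n, x n <= x0 <= x n + C * h n.
  move=> C0 xS.
  pose y n := x n + C * h n.
  have /nondecreasing_seqP xx : forall n, x n <= x n.+1 by move=> n; have [] := xS n.
  have /nonincreasing_seqP yy : forall n, y n.+1 <= y n by move=> n; have [] := xS n.
  have xy n k : x n <= y k.
    apply: (le_trans (xx _ _ (leq_maxl n k))).
    apply: le_trans (yy _ _ (leq_maxr n k)).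
    by rewrite /y lerDl mulr_ge0// ltW.
  exists (sup (range x)) => n; apply/andP; split.
    by apply: ub_le_sup; [exists (y 0%N) => _ [k _ <-]; exact: xy|exists n].
  by apply: ge_sup; [exists (x 0%N), 0%N|move=> _ [k _ <-]; exact: xy].
have [s0 s0P] : exists s0, forall n, s n <= s0 <= s n + A * h n.
  by apply: nest => // n; have [] := grel n.
have [t0 t0P] : exists t0, forall n, t n <= t0 <= t n + B * h n.
  by apply: nest => // n; have [] := grel n.
have ss n : [/\ a <= s n, s n <= s0, s0 <= s n + A * h n & s n + A * h n <= b].
  by have [_ [? ? _ _ _]] := ginv n; have /andP[] := s0P n.
have tt n : [/\ c <= t n, t n <= t0, t0 <= t n + B * h n & t n + B * h n <= d].
  by have [_ [_ _ ? ? _]] := ginv n; have /andP[] := t0P n.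
have s0ab : a <= s0 <= b by have [] := ss 0%N; lra.
have t0cd : c <= t0 <= d by have [] := tt 0%N; lra.
(* With [e = m / D] the local bound and [inv] together would give [D <= (A + B) ^+ 2], which the
   added 1 excludes. *)
pose D := (A + B) ^+ 2 + 1.
have D0 : 0 < D by rewrite ltr_wpDl ?sqr_ge0.
have [r r0 Hr] := Hloc s0 t0 (m / D) s0ab t0cd (divr_gt0 m0 D0).
have [n nr] : exists n, A * h n <= r /\ B * h n <= r.
  exists (Num.bound ((A + B) / r)).
  set n := Num.bound _.
  have : (A + B) * h n <= r.
    rewrite ler_pdivrMr ?exprn_gt0// mulrC -ler_pdivrMr//.
    apply: ltW; apply: lt_trans (natr_lt_exp2 _ _).
    exact: archi_boundP (divr_ge0 (addr_ge0 A0 B0) (ltW r0)).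
  rewrite mulrDl => AB; have := h0 n => hn.
  by split; apply: le_trans AB; rewrite ?lerDl ?lerDr mulr_ge0// ltW.
have [nA nB] := nr.
have := Hr _ _ _ _ (ss n) (tt n).
rewrite (addrAC (s n)) (addrAC (t n)) !subrr !add0r => /(_ nA nB).
have [_ [_ _ _ _ mh]] := ginv n.
move=> /(le_trans mh); rewrite -mulrDl exprMn [_ / D * _]mulrA.
rewrite ler_pM2r ?exprn_gt0// mulrAC ler_pdivlMr// ler_pM2l// /D.
lra.
Qed.

Lemma is_diff_eps (R : realType) (V W : normedModType R) (f df : V -> W)
    (x : V) (e : R) :
  is_diff x f df -> 0 < e ->
  exists2 r, 0 < r & forall y, `|y - x| < r ->
    `|f y - f x - df (y - x)| <= e * `|y - x|.
Proof.
move=> dfx e0; have [dx dfE] := dfx.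
have /eqaddoP/(_ _ e0) : f \o shift x = cst (f x) + 'd f x +o_ 0 id.
  exact: diff_locally.
rewrite dfE => /nbhs_norm0P[r /= r0 fr]; exists r => // y yr.
by have := fr _ yr; rewrite /= !fctE subrK opprD addrA.
Qed.

Lemma norm_pair_le (R : realType) (x y : R) : `|(x, y)| <= `|x| + `|y|.
Proof. by rewrite prod_normE/= ge_max lerDl lerDr !normr_ge0. Qed.

Lemma diff_pairE (R : realType) (P : R * R -> R) (z : R * R) (u v : R) :
  'd P z (u, v) = 'd P z (1, 0) * u + 'd P z (0, 1) * v.
Proof.
rewrite [_ * u]mulrC [_ * v]mulrC -[u * _]linearZ -[v * _]linearZ -linearD.
congr ('d P z _); congr pair; rewrite /=.
  by rewrite -[u *: 1]/(u * 1) -[v *: 0]/(v * 0) mulr1 mulr0 addr0.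
by rewrite -[v *: 1]/(v * 1) -[u *: 0]/(u * 0) mulr1 mulr0 add0r.
Qed.

Lemma differentiable_pair_eps (R : realType) (P : R * R -> R) (s t k l e : R) :
  differentiable P (s, t) ->
  'd P (s, t) (1, 0) = k -> 'd P (s, t) (0, 1) = l -> 0 < e ->
  exists2 r : R, 0 < r & forall u v : R, `|u - s| < r -> `|v - t| < r ->
    `|P (u, v) - P (s, t) - (k * (u - s) + l * (v - t))|
    <= e * (`|u - s| + `|v - t|).
Proof.
move=> dP <- <- e0; have [r r0 Pr] := is_diff_eps (differentiableP dP) e0.
exists r => // u v us vt; rewrite -diff_pairE.
apply: le_trans (Pr (u, v) _) _; first by rewrite prod_normE/= gt_max us.
by rewrite ler_wpM2l ?(ltW e0)// norm_pair_le.
Qed.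

(** The increment is the integral of [f x' - f x] over [[y, y']]; the mean value inequality compares
    this integrand with the constant [k * (x' - x)]. *)
Lemma rect_incr_approx (R : realType) (F f : R -> R -> R) (x x' y y' k e : R) :
  y <= y' ->
  (forall v, y <= v <= y' -> is_derive v 1 (F x) (f x v)) ->
  (forall v, y <= v <= y' -> is_derive v 1 (F x') (f x' v)) ->
  (forall v, y <= v <= y' -> `|f x' v - f x v - k * (x' - x)| <= e) ->
  `|rect_incr F x x' y y' - k * (x' - x) * (y' - y)| <= e * (y' - y).
Proof.
move=> yy dF dF' fe.
have -> : rect_incr F x x' y y' - k * (x' - x) * (y' - y) =
    (F x' - F x - (k * (x' - x)) *: id) y' -
    (F x' - F x - (k * (x' - x)) *: id) y.
  rewrite /rect_incr !fctE.
  by rewrite -[_ *: y]/(_ * y) -[_ *: y']/(_ * y'); ring.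
apply: mvt_bound yy _ fe => v yv; have ? := dF v yv; have ? := dF' v yv.
by apply: is_derive_eq; rewrite -[_ *: 1]/(_ * 1) mulr1.
Qed.

Lemma ler_norm_sub_itv (R : realType) (s s' u v : R) :
  s <= u <= s' -> s <= v <= s' -> `|u - v| <= s' - s.
Proof. by move=> su sv; rewrite ler_norml; lra. Qed.

Lemma itv_sub (R : realType) (a b s s' u : R) :
  a <= s -> s' <= b -> s <= u <= s' -> a <= u <= b.
Proof. lra. Qed.

(* Contour integrals are written with primitives: [Phi] and [Psi] are primitives
   of [P] and [Q] on vertical and horizontal lines, so that the equation is the
   vanishing of the integral of [Q ds + P dt] along the boundary. *)
Lemma goursat (R : realType) (P Q : R * R -> R) (Phi Psi : R -> R -> R)
    (a b c d : R) :
  a <= b -> c <= d ->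
  (forall z, a <= z.1 <= b -> c <= z.2 <= d ->
    [/\ differentiable P z, differentiable Q z,
        'd P z (1, 0) = 'd Q z (0, 1),
        is_derive z.2 1 (Phi z.1) (P z) & is_derive z.1 1 (Psi z.2) (Q z)]) ->
  rect_incr Phi a b c d = rect_incr (fun s t => Psi t s) a b c d.
Proof.
move=> ab cd PQ; apply/eqP; rewrite -subr_eq0.
suff <- : rect_incr (fun s t => Phi s t - Psi t s) a b c d =
  rect_incr Phi a b c d - rect_incr (fun s t => Psi t s) a b c d.
  apply/eqP/rect_incr_eq0 => // s0 t0 e s0ab t0cd e0.
  have [/= dP dQ PQz _ _] := PQ (s0, t0) s0ab t0cd.
  have e40 : 0 < e / 4 by rewrite divr_gt0.
  have e44 : e / 4 + e / 4 = e / 2 by field.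
  have [k Pk] : exists k, 'd P (s0, t0) (1, 0) = k by eexists.
  have [l Pl] : exists l, 'd P (s0, t0) (0, 1) = l by eexists.
  have [m Qm] : exists m, 'd Q (s0, t0) (1, 0) = m by eexists.
  (* The derivatives of [P] in [s] and of [Q] in [t] are the same number [k], so the main terms
     [k * (s' - s) * (t' - t)] of the two increments will cancel. *)
  have Qk := etrans (esym PQz) Pk.
  have [r1 r10 Pr] := differentiable_pair_eps dP Pk Pl e40.
  have [r2 r20 Qr] := differentiable_pair_eps dQ Qm Qk e40.
  (* The approximations hold for distances strictly below [M], whereas the sides are only bounded
     non-strictly; hence the radius [M / 2]. *)
  pose M := Num.min r1 r2; have M0 : 0 < M by rewrite lt_min r10.
  have rM : M / 2 < M by move: M0; clear; lra.
  have {}Pr u v : `|u - s0| <= M / 2 -> `|v - t0| <= M / 2 ->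
      `|P (u, v) - P (s0, t0) - (k * (u - s0) + l * (v - t0))|
      <= e / 4 * (`|u - s0| + `|v - t0|).
    by move=> uM vM; apply: Pr; apply: (le_lt_trans _ (lt_le_trans rM _));
      rewrite ?ge_min ?lexx.
  have {}Qr u v : `|u - s0| <= M / 2 -> `|v - t0| <= M / 2 ->
      `|Q (u, v) - Q (s0, t0) - (m * (u - s0) + k * (v - t0))|
      <= e / 4 * (`|u - s0| + `|v - t0|).
    by move=> uM vM; apply: Qr; apply: (le_lt_trans _ (lt_le_trans rM _));
      rewrite ?ge_min ?lexx ?orbT.
  exists (M / 2); first by rewrite divr_gt0.
  move=> s s' t t' [as_ ss0 s0s' s'b] [ct tt0 t0t' t'd] sr tr.
  have ss' : s <= s' := le_trans ss0 s0s'.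
  have tt' : t <= t' := le_trans tt0 t0t'.
  set L := (s' - s) + (t' - t).
  have exps u v : s <= u <= s' -> t <= v <= t' ->
     `|P (u, v) - P (s0, t0) - (k * (u - s0) + l * (v - t0))| <= e / 4 * L
  /\ `|Q (u, v) - Q (s0, t0) - (m * (u - s0) + k * (v - t0))| <= e / 4 * L.
    move=> su tv.
    have us : `|u - s0| <= s' - s by rewrite ler_norm_sub_itv// ss0.
    have vt : `|v - t0| <= t' - t by rewrite ler_norm_sub_itv// tt0.
    have uvL : e / 4 * (`|u - s0| + `|v - t0|) <= e / 4 * L.
      by rewrite ler_wpM2l ?(ltW e40)// lerD.
    have uM := le_trans us sr; have vM := le_trans vt tr.
    by split; [apply: le_trans (Pr _ _ uM vM) _|apply: le_trans (Qr _ _ uM vM) _].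
  have b1 : `|rect_incr Phi s s' t t' - k * (s' - s) * (t' - t)|
      <= e / 2 * L * (t' - t).
    apply: (@rect_incr_approx _ _ (fun x y => P (x, y))) => // v tv.
    - by have [] := PQ (s, v) (itv_sub as_ s'b _) (itv_sub ct t'd tv); rewrite /= ?lexx.
    - by have [] := PQ (s', v) (itv_sub as_ s'b _) (itv_sub ct t'd tv); rewrite /= ?lexx ?ss'.
    - have [] := exps s v; rewrite ?lexx ?ss' // => h1 _.
      have [] := exps s' v; rewrite ?lexx ?ss' // => h2 _.
      have -> : P (s', v) - P (s, v) - k * (s' - s) =
        (P (s', v) - P (s0, t0) - (k * (s' - s0) + l * (v - t0))) -
        (P (s, v) - P (s0, t0) - (k * (s - s0) + l * (v - t0))) by ring.
      apply: le_trans (ler_normB _ _) (le_trans (lerD h2 h1) _).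
      by rewrite -mulrDl e44.
  have b2 : `|rect_incr Psi t t' s s' - k * (t' - t) * (s' - s)|
      <= e / 2 * L * (s' - s).
    apply: (@rect_incr_approx _ _ (fun y x => Q (x, y))) => // v sv.
    - by have [] := PQ (v, t) (itv_sub as_ s'b sv) (itv_sub ct t'd _); rewrite /= ?lexx.
    - by have [] := PQ (v, t') (itv_sub as_ s'b sv) (itv_sub ct t'd _); rewrite /= ?lexx ?tt'.
    - have [] := exps v t; rewrite ?lexx ?tt' // => _ h1.
      have [] := exps v t'; rewrite ?lexx ?tt' // => _ h2.
      have -> : Q (v, t') - Q (v, t) - k * (t' - t) =
        (Q (v, t') - Q (s0, t0) - (m * (v - s0) + k * (t' - t0))) -
        (Q (v, t) - Q (s0, t0) - (m * (v - s0) + k * (t - t0))) by ring.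
      apply: le_trans (ler_normB _ _) (le_trans (lerD h2 h1) _).
      by rewrite -mulrDl e44.
  have -> : rect_incr (fun s t => Phi s t - Psi t s) s s' t t' =
    (rect_incr Phi s s' t t' - k * (s' - s) * (t' - t)) -
    (rect_incr Psi t t' s s' - k * (t' - t) * (s' - s)).
    by rewrite /rect_incr; ring.
  apply: le_trans (ler_normB _ _) (le_trans (lerD b1 b2) _).
  rewrite -mulrDr [t' - t + _]addrC -/L.
  have -> : e / 2 * L * L = e / 2 * L ^+ 2 by ring.
  by rewrite ler_wpM2r ?sqr_ge0//; move: e0; clear; lra.
by rewrite /rect_incr; ring.
Qed.

(** * The Cauchy estimate *)

Lemma is_diff_derive1 (R : realType) (V : normedModType R) (f : R -> V)
    (x : R) (d : V) :
  is_derive x 1 f d -> is_diff x f (fun h => h *: d).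
Proof.
move=> [df fd]; have dfx : differentiable f x by apply/derivable1_diffP.
by apply: DiffDef => //; rewrite diff1E// derive1E fd.
Qed.

Lemma is_diff_fst (R : realType) (z : R * R) : is_diff z fst fst.
Proof.
have cf : continuous (@fst R R) by move=> y; exact: cvg_fst.
exact: DiffDef (linear_differentiable _ cf) (diff_lin _ cf).
Qed.

Lemma is_diff_snd (R : realType) (z : R * R) : is_diff z snd snd.
Proof.
have cf : continuous (@snd R R) by move=> y; exact: cvg_snd.
exact: DiffDef (linear_differentiable _ cf) (diff_lin _ cf).
Qed.

(** The point [x + w] for [w = e^(s + i t)], where the plane spanned by [ea] and [eb] is read as the
    complex line with [ea = 1] and [eb = i]. The centre [x] corresponds to [s = -oo]. *)
Definition polar (R : realType) (V : normedModType R) (ea eb x : V)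
    (z : R * R) : V :=
  x + ((expR z.1 * cos z.2) *: ea + (expR z.1 * sin z.2) *: eb).

Lemma is_diff_polar (R : realType) (V : normedModType R) (ea eb x : V)
    (z : R * R) :
  is_diff z (polar ea eb x) (fun h =>
    (expR z.1 * (h.1 * cos z.2 - h.2 * sin z.2)) *: ea +
    (expR z.1 * (h.1 * sin z.2 + h.2 * cos z.2)) *: eb).
Proof.
have dfst := is_diff_fst z; have dsnd := is_diff_snd z.
have de := is_diff_comp dfst (is_diff_derive1 (is_derive_expR z.1)).
have dc := is_diff_comp dsnd (is_diff_derive1 (is_derive_cos z.2)).
have ds := is_diff_comp dsnd (is_diff_derive1 (is_derive_sin z.2)).
have dec := is_diffM de dc; have des := is_diffM de ds.
have da := is_diff_comp dec (is_diff_scalel _ ea).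
have db := is_diff_comp des (is_diff_scalel _ eb).
apply: (is_diff_eq (is_diffD (is_diff_cst x z) (is_diffD da db))).
apply/funext => h; rewrite !fctE /= add0r.
congr (_ *: _ + _ *: _).
  rewrite -[_ *: (h.2 *: _)]/(_ * (h.2 * _)) -[_ *: (h.1 *: _)]/(_ * (h.1 * _)).
  by ring.
rewrite -[_ *: (h.2 *: _)]/(_ * (h.2 * _)) -[_ *: (h.1 *: _)]/(_ * (h.1 * _)).
by ring.
Qed.

(* [p + i q] has derivative [a + i b] in the complex coordinate
   [alpha + i beta]. *)
Definition cr_pair (R : realType) (V : normedModType R) (alpha beta : V -> R)
    (D : set V) (p q a b : V -> R) : Prop :=
  forall x, D x ->
    is_diff x p (fun v => a x * alpha v - b x * beta v) /\
    is_diff x q (fun v => b x * alpha v + a x * beta v).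

(* Multiplication of [p + i q] by [-i]. *)
Lemma cr_pair_rot (R : realType) (V : normedModType R) (alpha beta : V -> R)
    (D : set V) (p q a b : V -> R) :
  cr_pair alpha beta D p q a b -> cr_pair alpha beta D q (- p) b (- a).
Proof.
move=> pq x /pq[dp dq]; split.
  by apply: is_diff_eq; apply/funext => v; rewrite fctE mulNr opprK.
by apply: is_diff_eq; apply/funext => v; rewrite !fctE mulNr opprB addrC.
Qed.

(* The real part of [f / w] for [f = p + i q] and [w = e^(s + i t)]; the
   imaginary part is [polar_re q (- p)]. *)
Definition polar_re (R : realType) (V : normedModType R) (ea eb x : V)
    (p q : V -> R) (z : R * R) : R :=
  expR (- z.1) * (p (polar ea eb x z) * cos z.2 + q (polar ea eb x z) * sin z.2).

(** In the coordinate [zeta = log w] one has [dw = w d zeta], so [f / w] has complex derivative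
    [f' - f / w]. The coefficient of [h.1] is its real part and that of [h.2] the real part of [i]
    times it. *)
Lemma is_diff_polar_re (R : realType) (V : normedModType R)
    (alpha beta : V -> R) (ea eb x : V) (D : set V) (p q a b : V -> R)
    (z : R * R) :
  (forall u v, alpha (u *: ea + v *: eb) = u) ->
  (forall u v, beta (u *: ea + v *: eb) = v) ->
  cr_pair alpha beta D p q a b -> D (polar ea eb x z) ->
  is_diff z (polar_re ea eb x p q) (fun h =>
     h.1 * (a (polar ea eb x z) - polar_re ea eb x p q z) +
     h.2 * (polar_re ea eb x q (- p) z - b (polar ea eb x z))).
Proof.
move=> alphaE betaE pq Dz; have [dp dq] := pq _ Dz.
have dfst := is_diff_fst z; have dsnd := is_diff_snd z.
have de := is_diff_comp (is_diffN dfst) (is_diff_derive1 (is_derive_expR (- z.1))).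
have dc := is_diff_comp dsnd (is_diff_derive1 (is_derive_cos z.2)).
have ds := is_diff_comp dsnd (is_diff_derive1 (is_derive_sin z.2)).
have dp' := is_diff_comp (is_diff_polar ea eb x z) dp.
have dq' := is_diff_comp (is_diff_polar ea eb x z) dq.
apply: (is_diff_eq
  (is_diffM de (is_diffD (is_diffM dp' dc) (is_diffM dq' ds)))).
apply/funext => h.
have cs := cos2Dsin2 z.2; have e0 := expRxMexpNx_1 z.1.
rewrite /polar_re !fctE /= !alphaE !betaE.
move: (p _) (q _) (a _) (b _) => p0 q0 a0 b0.
move: (expR z.1) (expR (- z.1)) (cos z.2) (sin z.2) cs e0 => e e' c s cs e0.
rewrite /GRing.scale/=.
transitivity ((e * e') * (c ^+ 2 + s ^+ 2) * (h.1 * a0 - h.2 * b0) -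
  h.1 * (e' * (p0 * c + q0 * s)) + h.2 * (e' * (q0 * c - p0 * s))).
  by ring.
by rewrite e0 cs; ring.
Qed.

Lemma polar_re_2pi (R : realType) (V : normedModType R) (ea eb x : V)
    (p q : V -> R) (s : R) :
  polar_re ea eb x p q (s, pi *+ 2) = polar_re ea eb x p q (s, 0).
Proof. by rewrite /polar_re /polar/= cos2pi sin2pi cos0 sin0. Qed.

Lemma norm_polar_sub (R : realType) (V : normedModType R) (ea eb x : V) (z : R * R) :
  `|polar ea eb x z - x| <= expR z.1 * (`|ea| + `|eb|).
Proof.
rewrite /polar [x + _]addrC addrK (le_trans (ler_normD _ _))// !normrZ ?normrM.
rewrite ger0_norm ?expR_ge0// mulrDr -!mulrA lerD//.
  by rewrite ler_wpM2l ?expR_ge0// ler_piMl// cos_max.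
by rewrite ler_wpM2l ?expR_ge0// ler_piMl// sin_max.
Qed.

Lemma norm_polar_re (R : realType) (V : normedModType R) (ea eb x : V)
    (p q : V -> R) (z : R * R) (M : R) :
  `|p (polar ea eb x z)| <= M -> `|q (polar ea eb x z)| <= M ->
  `|polar_re ea eb x p q z| <= 2 * M * expR (- z.1).
Proof.
move=> pM qM; rewrite normrM ger0_norm ?expR_ge0// mulrC ler_wpM2r ?expR_ge0//.
rewrite (le_trans (ler_normD _ _))// !normrM mulrDl !mul1r.
by rewrite lerD// -[leRHS]mulr1 ler_pM// ?cos_max ?sin_max.
Qed.

(* As [s -> -oo] the mean of [f / w] over the circle of radius [e^s] tends to
   the derivative of [f], the contribution of [f x / w] being zero. *)
Lemma polar_re_asymptotic (R : realType) (V : normedModType R)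
    (alpha beta : V -> R) (ea eb x : V) (p q a b : V -> R) (e : R) :
  (forall u v, alpha (u *: ea + v *: eb) = u) ->
  (forall u v, beta (u *: ea + v *: eb) = v) ->
  cr_pair alpha beta [set x] p q a b -> 0 < e ->
  exists S : R, forall s t, s <= S ->
    `|polar_re ea eb x p q (s, t) -
      (a x + expR (- s) * (p x * cos t + q x * sin t))| <= e.
Proof.
move=> alphaE betaE /(_ x erefl)[dp dq] e0.
pose K := `|ea| + `|eb| + 1.
have K0 : 0 < K by rewrite ltr_wpDl ?addr_ge0.
have eK : 0 < e / 2 / K by rewrite !divr_gt0.
have [r1 r10 pr] := is_diff_eps dp eK.
have [r2 r20 qr] := is_diff_eps dq eK.
pose r := Num.min r1 r2; have r0 : 0 < r by rewrite lt_min r10.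
exists (ln (r / K)) => s t sS.
have sr : expR s * K <= r.
  by rewrite -ler_pdivlMr// -[leRHS]lnK ?posrE ?divr_gt0// ler_expR.
set y := polar ea eb x (s, t).
have yxE : y - x = (expR s * cos t) *: ea + (expR s * sin t) *: eb.
  by rewrite /y /polar [x + _]addrC addrK.
have yx : `|y - x| < expR s * K.
  apply: le_lt_trans (norm_polar_sub _ _ _ _) _.
  by rewrite ltr_pM2l ?expR_gt0// /K ltrDl.
have yr1 : `|y - x| < r1 by rewrite (lt_le_trans yx)// (le_trans sr)// ge_min lexx.
have yr2 : `|y - x| < r2.
  by rewrite (lt_le_trans yx)// (le_trans sr)// ge_min lexx orbT.
have bnd : e / 2 / K * `|y - x| <= e / 2 * expR s.
  rewrite mulrAC ler_pdivrMr// -[leRHS]mulrA ler_wpM2l ?divr_ge0 ?(ltW e0)//.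
  exact: ltW.
have := le_trans (pr y yr1) bnd; have := le_trans (qr y yr2) bnd.
rewrite yxE !alphaE !betaE.
set E1 := q y - _ - _; set E2 := p y - _ - _ => hE1 hE2.
have es := expRxMexpNx_1 s; have cs := cos2Dsin2 t.
have -> : polar_re ea eb x p q (s, t) -
    (a x + expR (- s) * (p x * cos t + q x * sin t)) =
    expR (- s) * (E2 * cos t + E1 * sin t).
  rewrite /polar_re/= -/y /E1 /E2.
  move: (p y) (q y) (p x) (q x) (a x) (b x) => p1 q1 p0 q0 a0 b0.
  move: (expR s) (expR (- s)) (cos t) (sin t) cs es => u u' c d cs es.
  transitivity (u' * ((p1 - p0) * c + (q1 - q0) * d) - a0 * (u * u') * (c ^+ 2 + d ^+ 2)).
    by rewrite es cs; ring.
  by ring.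
rewrite normrM [X in X * _]ger0_norm ?expR_ge0//.
rewrite -[leRHS]mulr1 -es mulrCA mulrA mulrC ler_wpM2r ?expR_ge0//.
rewrite (le_trans (ler_normD _ _))// !normrM [leRHS](_ : _ = e / 2 * expR s + e / 2 * expR s).
  by rewrite lerD// -[leRHS]mulr1 ler_pM// ?cos_max ?sin_max.
by field.
Qed.

Lemma differentiable_continuous_sections (R : realType) (P : R * R -> R)
    (s t : R) :
  differentiable P (s, t) ->
  {for t, continuous (fun y => P (s, y))} /\
  {for s, continuous (fun y => P (y, t))}.
Proof.
move=> /differentiable_continuous cP; split.
  apply: (@continuous_comp _ _ _ (fun y : R => (s, y)) P t) => //.
  apply: (@cvg_pair _ _ _ (nbhs t) (nbhs s) (nbhs t) _ _ _ (fun=> s) id).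
    exact: cvg_cst.
  exact: cvg_id.
apply: (@continuous_comp _ _ _ (fun y : R => (y, t)) P s) => //.
apply: (@cvg_pair _ _ _ (nbhs s) (nbhs s) (nbhs t) _ _ _ id (fun=> t)).
  exact: cvg_id.
exact: cvg_cst.
Qed.

(** The primitives for different [s] are chosen independently; the contour argument only uses each
    of them along its own line. *)
Lemma family_primitive (R : realType) (f : R -> R -> R) (X : set R) (a b : R) :
  (forall s, X s -> forall t, a <= t <= b -> {for t, continuous (f s)}) ->
  exists F : R -> R -> R, forall s, X s -> forall t, a < t < b ->
    is_derive t 1 (F s) (f s t).
Proof.
move=> cf.
have /choice[F HF] : forall s, exists G : R -> R, X s -> forall t, a < t < b ->
    is_derive t 1 G (f s t).
  move=> s; have [Xs|nXs] := pselect (X s); last by exists (f s).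
  by have [G GP] := continuous_primitive (cf s Xs); exists G.
by exists F.
Qed.

Lemma polar_reNN (R : realType) (V : normedModType R) (ea eb x : V)
    (p q : V -> R) (z : R * R) :
  polar_re ea eb x (- p) (- q) z = - polar_re ea eb x p q z.
Proof. by rewrite /polar_re !fctE /= !mulNr -opprD mulrN. Qed.

(** Goursat's theorem on [[s0, S] x [0, 2 pi]] shows that the mean of [Re (f / w)] over the circle
    of radius [e^s] is the same for [s0] and [S]. At [S] it is at most [2 * M * expR (- S)]; for
    [s0] near [-oo] it is close to [a x]. *)
Lemma cauchy_estimate_polar (R : realType) (V : normedModType R)
    (alpha beta : V -> R) (ea eb x : V) (D : set V) (p q a b : V -> R)
    (S M : R) :
  (forall u v, alpha (u *: ea + v *: eb) = u) ->
  (forall u v, beta (u *: ea + v *: eb) = v) ->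
  cr_pair alpha beta D p q a b -> D x ->
  (forall s t, s <= S + 1 -> D (polar ea eb x (s, t))) ->
  (forall y, D y -> `|p y| <= M) -> (forall y, D y -> `|q y| <= M) ->
  `|a x| <= 2 * M * expR (- S).
Proof.
move=> alphaE betaE pq Dx DS pM qM.
pose P := polar_re ea eb x p q; pose Q := polar_re ea eb x q (- p).
pose T : R := pi *+ 2.
have T0 : 0 < T by rewrite mulrn_wgt0// pi_gt0.
have dP s t : s <= S + 1 -> is_diff (s, t) P _ :=
  fun sS => is_diff_polar_re alphaE betaE pq (DS s t sS).
have dQ s t : s <= S + 1 -> is_diff (s, t) Q _ :=
  fun sS => is_diff_polar_re alphaE betaE (cr_pair_rot pq) (DS s t sS).
(* Primitives are differentiable only inside the interval on which they are built, so all intervals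
   are widened by 1. *)
have SS1 : S <= S + 1 by rewrite lerDl.
have [Phi dPhi] : exists Phi : R -> R -> R, forall s, s <= S + 1 ->
    forall t, -1 < t < T + 1 -> is_derive t 1 (Phi s) (P (s, t)).
  apply: (@family_primitive _ (fun s t => P (s, t)) [set s | s <= S + 1]) => s /= sS t _.
  by have [dPs _] := dP s t sS; have [] := differentiable_continuous_sections dPs.
(* The integral of [Re (f / w)] over the circle of radius [e^s], that is [2 pi] times its mean. *)
pose I s := Phi s T - Phi s 0.
have inT t : 0 <= t <= T -> -1 < t < T + 1.
  by move=> /andP[t0 tT]; rewrite (lt_le_trans _ t0) ?ltrN10//= (le_lt_trans tT)// ltrDl.
have I_cst s0 : s0 <= S -> I s0 = I S.
  move=> s0S.
  have [Psi dPsi] : exists Psi : R -> R -> R, forall t, setT t ->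
      forall s, s0 - 1 < s < S + 1 -> is_derive s 1 (Psi t) (Q (s, t)).
    apply: (@family_primitive _ (fun t s => Q (s, t)) setT) => t _ s /andP[_ sS].
    by have [dQs _] := dQ s t sS; have [] := differentiable_continuous_sections dQs.
  have ins s : s0 <= s <= S -> s0 - 1 < s < S + 1.
    move=> /andP[s0s sS]; rewrite (lt_le_trans _ s0s) ?ltrBlDr ?ltrDl//=.
    by rewrite (le_lt_trans sS)// ltrDl.
  have : rect_incr Phi s0 S 0 T = rect_incr (fun s t => Psi t s) s0 S 0 T.
    apply: (@goursat R P Q) => [//||[s t] /= sI tI]; first exact: ltW.
    have sS : s <= S + 1 by case/andP: sI => _ /le_trans; exact.
    have [dPs dPE] := dP s t sS; have [dQs dQE] := dQ s t sS.
    split => //.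
    - apply: (etrans (congr1 (@^~ (1, 0)) dPE)).
      apply: (etrans _ (esym (congr1 (@^~ (0, 1)) dQE))).
      by rewrite /= polar_reNN !mul0r !mul1r addr0 add0r opprK addrC.
    - exact: dPhi (inT _ tI).
    - exact: dPsi (ins _ sI).
  have -> : rect_incr Phi s0 S 0 T = I S - I s0 by rewrite /I /rect_incr; ring.
  have -> : rect_incr (fun s t => Psi t s) s0 S 0 T =
      (Psi T - Psi 0) S - (Psi T - Psi 0) s0.
    by rewrite /rect_incr !fctE; ring.
  (* The two horizontal sides cancel: [Q] agrees at angles 0 and [2 pi], so [Psi T] and [Psi 0] have
     equal derivatives and differ by a constant. *)
  suff -> : (Psi T - Psi 0) S - (Psi T - Psi 0) s0 = 0.
    by move=> /eqP; rewrite subr_eq0 => /eqP.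
  apply/eqP; rewrite -normr_le0 -[leRHS](mul0r (S - s0)).
  apply: (@mvt_bound _ _ (fun=> 0)) => // [s sI|s _]; last by rewrite normr0.
  have ? := dPsi T Logic.I s (ins _ sI); have ? := dPsi 0 Logic.I s (ins _ sI).
  by apply: is_derive_eq; rewrite /Q /T polar_re_2pi subrr.
have IS : `|I S| <= 2 * M * expR (- S) * T.
  rewrite -[X in _ * X]subr0.
  apply: (@mvt_bound _ _ (fun t => P (S, t))) => [|t /inT tI|t tI].
  - exact: ltW.
  - exact: dPhi tI.
  - by have := DS S t SS1 => Dz; apply: norm_polar_re; [exact: pM|exact: qM].
suff aT : forall e, 0 < e -> `|a x| * T <= 2 * M * expR (- S) * T + e * T.
  apply/ler_addgt0Pr => e e0; rewrite -(ler_pM2r T0) mulrDl; exact: aT.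
move=> e e0.
have [S0 PS0] : exists S0 : R, forall s t, s <= S0 ->
    `|P (s, t) - (a x + expR (- s) * (p x * cos t + q x * sin t))| <= e.
  apply: (polar_re_asymptotic alphaE betaE _ e0) => y ->; exact: pq.
pose s0 := Num.min S0 S.
have s0S : s0 <= S by rewrite ge_min lexx orbT.
have s0S0 : s0 <= S0 by rewrite ge_min lexx.
(* A primitive of the error in the asymptotic formula. Over a full period the sine and cosine terms
   drop out, leaving [I s0 - a x * T]. *)
pose G := Phi s0 - ((a x) *: id + (expR (- s0) * p x) *: sin - (expR (- s0) * q x) *: cos).
have GE : G T - G 0 = I s0 - a x * T.
  rewrite /G /I !fctE /T cos2pi sin2pi cos0 sin0 /GRing.scale /=; ring.
have Ge : `|G T - G 0| <= e * T.
  rewrite -[X in _ * X]subr0.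
  apply: (@mvt_bound _ _ (fun t => P (s0, t) - (a x + expR (- s0) * (p x * cos t + q x * sin t)))).
  - exact: ltW.
  - move=> t /inT tI.
    apply: (is_derive_eq (is_deriveB (dPhi s0 (le_trans s0S SS1) t tI)
      (is_deriveB (is_deriveD (is_deriveZ _ (is_derive_id t 1))
        (is_deriveZ _ (is_derive_sin t))) (is_deriveZ _ (is_derive_cos t))))).
    rewrite /GRing.scale/=.
    move: (P _) (sin t) (cos t) (expR _) (a x) (p x) (q x) => P0 st ct e1 a0 p0 q0.
    ring.
  - by move=> t _; exact: PS0.
have -> : `|a x| * T = `|I S - (G T - G 0)|.
  rewrite GE I_cst// opprB addrC subrK normrM; congr (_ * _).
  by rewrite ger0_norm// ltW.
by apply: le_trans (ler_normB _ _) (lerD _ _).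
Qed.

(** * Derivatives of holomorphic pairs *)

Lemma is_diff_quadratic (R : realType) (V W : normedModType R) (f : V -> W)
    (L : {linear V -> W}) (x : V) (C r : R) :
  continuous L -> 0 < r ->
  (forall v, `|v| < r -> `|f (x + v) - f x - L v| <= C * `|v| ^+ 2) ->
  is_diff x f L.
Proof.
move=> cL r0 fL.
have dL : f \o shift x = cst (f x) + L +o_ 0 id.
  apply/eqaddoP => e e0; apply/nbhs_norm0P.
  pose D := `|C| + 1; have D0 : 0 < D by rewrite ltr_wpDl.
  exists (Num.min r (e / D)); first by rewrite /= lt_min r0 divr_gt0.
  move=> v /=; rewrite lt_min => /andP[vr ve].
  rewrite !fctE opprD addrA [v + x]addrC (le_trans (fL v vr))//.
  rewrite expr2 mulrA ler_wpM2r//.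
  have : `|v| * D <= e by rewrite -ler_pdivlMr// ltW.
  apply: le_trans; rewrite mulrC ler_wpM2l// /D.
  by rewrite (le_trans (ler_norm _))// lerDl.
have dfE := diff_unique cL dL.
by apply: DiffDef => //; apply/diff_locallyP; rewrite dfE.
Qed.

Lemma is_diff_line (R : realType) (V : normedModType R) (f df : V -> R)
    (y v : V) (t : R) :
  is_diff (y + t *: v) f df -> is_derive t 1 (fun t => f (y + t *: v)) (df v).
Proof.
move=> dfy.
have dl : is_diff t (fun t : R => y + t *: v) (fun h => h *: v).
  apply: (is_diff_eq (is_diffD (is_diff_cst y t) (is_diff_scalel t v))).
  by apply/funext => h; rewrite !fctE add0r.
have [dg dgE] := is_diff_comp dl dfy.
have ? := derivableP (proj2 (derivable1_diffP _ _) dg).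
by apply: is_derive_eq; rewrite deriveE// dgE /= scale1r.
Qed.

Lemma mvt_segment_bound (R : realType) (V : normedModType R) (f : V -> R)
    (df : R -> V -> R) (y v : V) (L B : R) :
  (forall t, 0 <= t <= 1 -> is_diff (y + t *: v) f (df t)) ->
  (forall t, 0 <= t <= 1 -> `|df t v - L| <= B) ->
  `|f (y + v) - f y - L| <= B.
Proof.
move=> fdf dfB.
pose g t := f (y + t *: v) - L * t.
have := @mvt_bound R g (fun t => df t v - L) 0 1 B ler01 _ dfB.
rewrite /g scale1r scale0r addr0 mulr0 mulr1 !subr0 mulr1.
rewrite addrAC; apply => t /fdf/is_diff_line dt.
apply: (is_derive_eq (is_deriveB dt (is_deriveZ L (is_derive_id t 1)))).
by rewrite /GRing.scale/= mulr1.
Qed.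

(** Passage to the limit [h -> 0] in an inequality with an error of order [h]. *)
Lemma ler_rate (R : realType) (X Y C eta : R) :
  0 < eta -> (forall h, 0 < h <= eta -> X <= Y + C * h) -> X <= Y.
Proof.
move=> eta0 XY; apply/ler_addgt0Pr => e e0.
pose D := `|C| + 1; have D0 : 0 < D by rewrite ltr_wpDl.
pose h := Num.min eta (e / D).
have h0 : 0 < h by rewrite lt_min eta0 divr_gt0.
have /XY/le_trans : 0 < h <= eta by rewrite h0 ge_min lexx.
apply; rewrite lerD2l (@le_trans _ _ (D * h))//.
  by rewrite ler_wpM2r ?(ltW h0)// /D (le_trans (ler_norm _))// lerDl.
by rewrite mulrC -ler_pdivlMr// ge_min lexx orbT.
Qed.

(** Cauchy's criterion with a linear rate: every [f h - C * h] lies below every [f k + C * k], and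
    the supremum of the former is the limit. *)
Lemma lim_rate (R : realType) (f : R -> R) (C eta : R) :
  0 < eta ->
  (forall h k, 0 < h <= eta -> 0 < k <= eta -> `|f h - f k| <= C * (h + k)) ->
  exists l, forall h, 0 < h <= eta -> `|f h - l| <= C * h.
Proof.
move=> eta0 fC.
pose E := [set f h - C * h | h in [set h | 0 < h <= eta]].
have ub k : 0 < k <= eta -> ubound E (f k + C * k).
  move=> hk _ [h hh <-]; have := fC _ _ hh hk.
  by move=> /ler_normlP[_]; rewrite mulrDr; lra.
have E0 : E (f eta - C * eta) by exists eta => //=; rewrite eta0 lexx.
exists (sup E) => h hh; apply/ler_normlP; rewrite opprB; split.
  rewrite lerBlDr addrC; apply: ge_sup; last exact: ub.
  by exists (f eta - C * eta).
rewrite lerBlDl -lerBlDr; apply: ub_le_sup; last by exists h.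
by exists (f h + C * h); exact: ub.
Qed.

Lemma ler_norm_sum5 (R : realType) (u1 u2 u3 u4 u5 t e c d : R) :
  `|u1| <= t -> `|u2| <= e -> `|u3| <= e -> `|u4| <= c -> `|u5| <= d ->
  `|u1 - u2 + u3 + (u4 - u5)| <= t + (e + e + (c + d)).
Proof.
move=> h1 h2 h3 h4 h5; rewrite (le_trans (ler_normD _ _))// !addrA -(addrA _ c).
rewrite lerD//; last by rewrite (le_trans (ler_normB _ _))// lerD.
rewrite (le_trans (ler_normD _ _))// lerD//.
by rewrite (le_trans (ler_normB _ _))// lerD.
Qed.

Section CauchyRiemannPair.
Context (R : realType) (V : normedModType R) (alpha beta : {linear V -> R^o})
  (ea eb : V) (K : R)
  (alphaE : forall u v : R, alpha (u *: ea + v *: eb) = u)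
  (betaE : forall u v : R, beta (u *: ea + v *: eb) = v)
  (alphaK : forall v, `|alpha v| <= K * `|v|)
  (betaK : forall v, `|beta v| <= K * `|v|).

Let cr := cr_pair alpha beta.

Let bounded_pair (D : set V) (p q : V -> R) (M : R) :=
  forall y, D y -> `|p y| <= M /\ `|q y| <= M.

Lemma form_bound_ge0 : 0 <= K.
Proof.
have ea0 : 0 < `|ea|.
  rewrite normr_gt0; apply/eqP => ea0.
  have := alphaE 1 0; rewrite ea0 scaler0 scale0r addr0 linear0 => /esym/eqP.
  by rewrite oner_eq0.
by rewrite -(pmulr_lge0 _ ea0) (le_trans _ (alphaK ea)).
Qed.

Lemma cr_pairS (D E : set V) p q a b :
  D `<=` E -> cr E p q a b -> cr D p q a b.
Proof. by move=> DE pq x /DE; exact: pq. Qed.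

Lemma cr_pairZ (k : R) (D : set V) p q a b :
  cr D p q a b -> cr D (k *: p) (k *: q) (k *: a) (k *: b).
Proof.
move=> pq x /pq[dp dq]; split; apply: is_diff_eq; apply/funext => v.
  by rewrite !fctE scalerBr -!scalerAl.
by rewrite !fctE scalerDr -!scalerAl.
Qed.

Lemma cr_pairB (D : set V) p q a b p' q' a' b' :
  cr D p q a b -> cr D p' q' a' b' ->
  cr D (p - p') (q - q') (a - a') (b - b').
Proof.
move=> pq pq' x Dx; have [dp dq] := pq x Dx; have [dp' dq'] := pq' x Dx.
by split; apply: is_diff_eq; apply/funext => v; rewrite !fctE; ring.
Qed.

Lemma cr_pair_shift (D : set V) (w : V) p q a b :
  cr [set y | D (y - w)] p q a b ->
  cr D (fun y => p (y + w)) (fun y => q (y + w))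
       (fun y => a (y + w)) (fun y => b (y + w)).
Proof.
move=> pq x Dx.
have [|dp dq] := pq (x + w); first by rewrite /= addrK.
have dw : is_diff x (fun y => y + w) id.
  apply: (is_diff_eq (is_diffD (is_diff_id x) (is_diff_cst w x))).
  by apply/funext => v; rewrite !fctE addr0.
by split; [exact: (is_diff_comp dw dp)|exact: (is_diff_comp dw dq)].
Qed.

(** The constant depends on the radius but not on the pair, which allows the estimate to be applied
    uniformly to increments and difference quotients. *)
Lemma cauchy_estimate (r : R) : 0 < r ->
  exists2 C, 0 <= C & forall D p q a b M,
    cr D p q a b -> bounded_pair D p q M ->
    bounded_pair [set x | ball x r `<=` D] a b (C * M).
Proof.
move=> r0; pose K' := `|ea| + `|eb| + 1.
have K0 : 0 < K' by rewrite ltr_wpDl ?addr_ge0.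
(* Chosen so that [expR (S + 1) * K' = r]: all circles with [s <= S + 1] stay in [ball x r]. *)
pose S := ln (r / K') - 1.
exists (2 * expR (- S)); first by rewrite mulr_ge0 ?expR_ge0.
move=> D p q a b M pq pqM x /= xD.
have Dx : D x by exact/xD/ballxx.
have DS s t : s <= S + 1 -> D (polar ea eb x (s, t)).
  move=> sS; apply: xD; rewrite -ball_normE /ball_/= distrC.
  apply: le_lt_trans (norm_polar_sub _ _ _ _) _.
  have sr : expR s * K' <= r.
    rewrite -ler_pdivlMr// -[leRHS]lnK ?posrE ?divr_gt0// ler_expR.
    by rewrite (le_trans sS)// /S subrK.
  by apply: lt_le_trans sr; rewrite ltr_pM2l ?expR_gt0// /K' ltrDl.
have pM y : D y -> `|p y| <= M by move=> /pqM[].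
have qM y : D y -> `|q y| <= M by move=> /pqM[].
rewrite mulrAC; split.
  exact: (cauchy_estimate_polar alphaE betaE pq Dx DS pM qM).
(* The function [- i f] has [b] as the real part of its derivative. *)
apply: (cauchy_estimate_polar alphaE betaE (cr_pair_rot pq) Dx DS qM) => y.
by rewrite fctE normrN; exact: pM.
Qed.

Lemma ball_shift (x y v : V) (r s : R) :
  ball x r y -> `|v| <= s -> ball x (r + s) (y + v).
Proof.
rewrite -ball_normE /ball_/= opprD addrA => xy vs.
by rewrite (le_lt_trans (ler_normB _ _))// ltr_leD.
Qed.

Lemma cr_pair_increment (D : set V) p q a b M y v :
  cr D p q a b -> bounded_pair D a b M ->
  (forall t, 0 <= t <= 1 -> D (y + t *: v)) ->
  `|p (y + v) - p y| <= 2 * K * M * `|v| /\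
  `|q (y + v) - q y| <= 2 * K * M * `|v|.
Proof.
move=> pq abM Dyv.
have aux t : 0 <= t <= 1 -> `|a (y + t *: v) * alpha v| <= M * (K * `|v|) /\
    `|b (y + t *: v) * beta v| <= M * (K * `|v|) /\
    `|b (y + t *: v) * alpha v| <= M * (K * `|v|) /\
    `|a (y + t *: v) * beta v| <= M * (K * `|v|).
  move=> /Dyv/abM[aM bM].
  by do !split; rewrite normrM ler_pM.
have E : 2 * K * M * `|v| = M * (K * `|v|) + M * (K * `|v|) by ring.
split; rewrite -[X in `|X| <= _]subr0 E.
  apply: (@mvt_segment_bound _ _ _ (fun t w => a (y + t *: v) * alpha w - b (y + t *: v) * beta w)).
    by move=> t /Dyv/pq[].
  move=> t /aux[a1 [b1 _]]; rewrite subr0.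
  exact: le_trans (ler_normB _ _) (lerD a1 b1).
apply: (@mvt_segment_bound _ _ _ (fun t w => b (y + t *: v) * alpha w + a (y + t *: v) * beta w)).
  by move=> t /Dyv/pq[].
move=> t /aux[_ [_ [b1 a1]]]; rewrite subr0.
exact: le_trans (ler_normD _ _) (lerD b1 a1).
Qed.

Lemma sub_ball_shift (x y : V) (r s : R) :
  ball x r y -> ball y s `<=` ball x (r + s).
Proof.
by move=> xy z; exact: ball_triangle.
Qed.

Lemma segment_ball (x v : V) (s t : R) :
  0 < s -> `|v| <= s -> 0 <= t <= 1 -> ball x (s + s) (x + t *: v).
Proof.
move=> s0 vs /andP[t0 t1]; apply: ball_shift; first exact: ballxx.
by rewrite normrZ ger0_norm// (le_trans _ vs)// ler_piMl.
Qed.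

(** The increment [f (y + v) - f y] is again holomorphic and, by a first Cauchy estimate, of size
    [M * |v|]; a second Cauchy estimate bounds its derivative. One [s] is spent on each estimate and
    one on the shift by [v]. *)
Lemma cr_pair_lipschitz (s : R) : 0 < s ->
  exists2 C, 0 <= C & forall D p q a b M x v,
    cr D p q a b -> bounded_pair D p q M ->
    ball x (s + s + s) `<=` D -> `|v| <= s ->
    `|a (x + v) - a x| <= C * M * `|v| /\ `|b (x + v) - b x| <= C * M * `|v|.
Proof.
move=> s0; have [C C0 HC] := cauchy_estimate s0.
exists (C * (2 * K * C)).
  by have K0 := form_bound_ge0; rewrite !mulr_ge0.
move=> D p q a b M x v pq pqM xD vs.
have Dp : bounded_pair (ball x (s + s)) a b (C * M).
  by move=> y xy; apply: HC pq pqM _ _ => z /(sub_ball_shift xy)/xD.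
have inD y t : ball x s y -> 0 <= t <= 1 -> ball x (s + s) (y + t *: v).
  move=> xy /andP[t0 t1]; apply: ball_shift xy _.
  by rewrite normrZ ger0_norm// (le_trans _ vs)// ler_piMl.
have subD : ball x (s + s) `<=` D.
  by move=> y xy; apply: xD; apply: le_ball xy; rewrite lerDl ltW.
have pqs := cr_pairS subD pq.
have pqv : cr (ball x s) (fun y => p (y + v)) (fun y => q (y + v))
    (fun y => a (y + v)) (fun y => b (y + v)).
  apply: cr_pair_shift; apply: cr_pairS pqs => y /= xy.
  by rewrite -[y](subrK v); exact: ball_shift.
have sub : ball x s `<=` ball x (s + s) by apply: le_ball; rewrite lerDl ltW.
have dpq := cr_pairB pqv (cr_pairS sub pqs).
have := HC _ _ _ _ _ (2 * K * (C * M) * `|v|) dpq _ x (fun _ => id).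
rewrite !fctE; have -> : C * (2 * K * (C * M) * `|v|) = C * (2 * K * C) * M * `|v| by ring.
apply=> y xy; rewrite ?fctE.
by apply: cr_pair_increment pqs Dp _ => t; exact: inD.
Qed.

(** The derivative being Lipschitz, the mean value inequality on the segment from [x] to [x + v]
    gives a quadratic remainder, again with a constant independent of the pair. *)
Lemma cr_pair_taylor (s : R) : 0 < s ->
  exists2 C, 0 <= C & forall D p q a b M x v,
    cr D p q a b -> bounded_pair D p q M ->
    ball x (s + s + s) `<=` D -> `|v| <= s ->
    `|p (x + v) - p x - (a x * alpha v - b x * beta v)| <= C * M * `|v| ^+ 2 /\
    `|q (x + v) - q x - (b x * alpha v + a x * beta v)| <= C * M * `|v| ^+ 2.
Proof.
move=> s0; have [C C0 HC] := cr_pair_lipschitz s0.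
have K0 := form_bound_ge0.
exists (2 * K * C); first by rewrite !mulr_ge0.
move=> D p q a b M x v pq pqM xD vs.
have M0 : 0 <= M.
  have Dx : D x by apply/xD/ballxx; rewrite !addr_gt0.
  by have [+ _] := pqM x Dx; apply: le_trans.
have Dv t : 0 <= t <= 1 -> D (x + t *: v).
  move=> /(segment_ball x s0 vs) h; apply: xD.
  by apply: le_ball h; rewrite lerDl ltW.
have aux t : 0 <= t <= 1 ->
    `|a (x + t *: v) - a x| <= C * M * `|v| /\
    `|b (x + t *: v) - b x| <= C * M * `|v|.
  move=> /andP[t0 t1].
  have tv : `|t *: v| <= `|v| by rewrite normrZ ger0_norm// ler_piMl.
  have [h1 h2] := HC _ _ _ _ _ _ _ _ pq pqM xD (le_trans tv vs).
  by split; [apply: le_trans h1 _|apply: le_trans h2 _]; rewrite ler_wpM2l// mulr_ge0.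
have E : 2 * K * C * M * `|v| ^+ 2 =
    C * M * `|v| * (K * `|v|) + C * M * `|v| * (K * `|v|) by ring.
rewrite E; split.
  apply: (@mvt_segment_bound _ _ _
    (fun t w => a (x + t *: v) * alpha w - b (x + t *: v) * beta w)).
    by move=> t /Dv/pq[].
  move=> t /aux[a1 b1].
  have -> : a (x + t *: v) * alpha v - b (x + t *: v) * beta v -
      (a x * alpha v - b x * beta v) =
      (a (x + t *: v) - a x) * alpha v - (b (x + t *: v) - b x) * beta v by ring.
  by rewrite (le_trans (ler_normB _ _))// !normrM lerD// ler_pM.
apply: (@mvt_segment_bound _ _ _
  (fun t w => b (x + t *: v) * alpha w + a (x + t *: v) * beta w)).
  by move=> t /Dv/pq[].
move=> t /aux[a1 b1].
have -> : b (x + t *: v) * alpha v + a (x + t *: v) * beta v -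
    (b x * alpha v + a x * beta v) =
    (b (x + t *: v) - b x) * alpha v + (a (x + t *: v) - a x) * beta v by ring.
by rewrite (le_trans (ler_normD _ _))// !normrM lerD// ler_pM.
Qed.

Lemma is_diff_comb (f : V -> R) (c d : R) (x : V) (C r : R) :
  0 < r ->
  (forall v, `|v| < r ->
    `|f (x + v) - f x - (c * alpha v + d * beta v)| <= C * `|v| ^+ 2) ->
  is_diff x f (fun v => c * alpha v + d * beta v).
Proof.
move=> r0 fL.
have lcont (l : {linear V -> R^o}) : (forall v, `|l v| <= K * `|v|) -> continuous l.
  move=> lK; apply: bounded_linear_continuous; apply/linear_boundedP.
  exists K; split; first exact: num_real.
  by move=> M KM v; rewrite (le_trans (lK v))// ler_wpM2r// ltW.
apply: (@is_diff_quadratic _ _ R^o f (c \*: alpha \+ d \*: beta) x C r) => //.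
by move=> v; apply: cvgD; apply: cvgZl_tmp; exact: lcont.
Qed.

(* The difference quotients of a Cauchy-Riemann pair in the direction [ea] are
   again Cauchy-Riemann pairs and converge uniformly to the derivative, so the
   Cauchy estimate makes their derivatives converge and Taylor's estimate
   passes to the limit. *)
Lemma cr_pair_derivative_at (D : set V) p q a b M (x : V) (s : R) :
  0 < s -> cr D p q a b -> bounded_pair D p q M ->
  ball x ((s + s + s) + (s + s + s)) `<=` D ->
  exists ab2 : R * R,
    is_diff x a (fun v => ab2.1 * alpha v - ab2.2 * beta v) /\
    is_diff x b (fun v => ab2.2 * alpha v + ab2.1 * beta v).
Proof.
move=> s0 pq pqM xD.
(* Taylor's estimate costs the radius [r] twice: for the pair at the points of [ball x r], then for
   its difference quotients at [x]. *)
pose r := s + s + s; have r0 : 0 < r by rewrite !addr_gt0.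
have sr : s <= r by rewrite /r -addrA lerDl addr_ge0// ltW.
have [C1 C10 HC1] := cauchy_estimate s0.
have [C2 C20 HC2] := cr_pair_taylor s0.
have M0 : 0 <= M.
  have Dx : D x by apply/xD/ballxx; rewrite addr_gt0.
  by have [+ _] := pqM x Dx; apply: le_trans.
have abM : bounded_pair (ball x r) a b (C1 * M).
  move=> y xy; apply: HC1 pq pqM _ _; apply: (subset_trans (le_ball sr)).
  exact: (subset_trans (sub_ball_shift xy)).
have N0 : 0 < `|ea| + 1 by rewrite ltr_wpDl.
pose eta := s / (`|ea| + 1); have eta0 : 0 < eta by rewrite divr_gt0.
pose E := C2 * M * `|ea| ^+ 2.
have E0 : 0 <= E by rewrite !mulr_ge0// sqr_ge0.
have hea h : 0 < h <= eta -> `|h *: ea| <= s.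
  move=> /andP[h0 heta]; rewrite normrZ gtr0_norm//.
  have : h * (`|ea| + 1) <= s by rewrite -ler_pdivlMr.
  by apply: le_trans; rewrite ler_wpM2l ?lerDl// ltW.
have [ah bh] : (forall h, alpha (h *: ea) = h) /\ (forall h, beta (h *: ea) = 0).
  by split=> h; have := alphaE h 0; have := betaE h 0; rewrite scale0r addr0.
pose dq (f : V -> R) h := h^-1 *: ((fun y => f (y + h *: ea)) - f).
have dqE f h y : dq f h y = h^-1 * (f (y + h *: ea) - f y) by [].
(* As [alpha (h *: ea) = h] and [beta (h *: ea) = 0], Taylor's estimate divided by [h] gives
   convergence of order [h], uniformly on [ball x r]. *)
have dq_near h y : 0 < h <= eta -> ball x r y ->
    `|dq p h y - a y| <= E * h /\ `|dq q h y - b y| <= E * h.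
  move=> hh xy; have /andP[h0 _] := hh.
  have yD : ball y (s + s + s) `<=` D by exact: (subset_trans (sub_ball_shift xy)).
  have := HC2 _ _ _ _ _ _ _ _ pq pqM yD (hea h hh).
  rewrite ah bh !mulr0 subr0 addr0 normrZ gtr0_norm// exprMn => -[h1 h2].
  have hE : C2 * M * (h ^+ 2 * `|ea| ^+ 2) = h * (E * h) by rewrite /E; ring.
  rewrite hE in h1 h2.
  rewrite !dqE; split; rewrite -(ler_pM2l h0).
    apply: le_trans h1; rewrite -[X in X * _](gtr0_norm h0) -normrM mulrBr mulVKf ?gt_eqF//.
    by rewrite (mulrC h).
  apply: le_trans h2; rewrite -[X in X * _](gtr0_norm h0) -normrM mulrBr mulVKf ?gt_eqF//.
  by rewrite (mulrC h).
have dq_cr h : 0 < h <= eta -> cr (ball x r) (dq p h) (dq q h) (dq a h) (dq b h).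
  move=> hh; apply: cr_pairZ; apply: cr_pairB; last first.
    by apply: cr_pairS pq; apply: (subset_trans _ xD); apply: le_ball; rewrite lerDl ltW.
  apply: cr_pair_shift; apply: cr_pairS pq => y /= xy; apply: xD.
  rewrite -[y](subrK (h *: ea)); apply: ball_shift xy _.
  exact: le_trans (hea h hh) sr.
have xr : ball x r x by exact: ballxx.
(* Cauchy estimate for the difference of two quotients, of size [E * (h + k)] on [ball x r]. *)
have rate h k : 0 < h <= eta -> 0 < k <= eta ->
    `|dq a h x - dq a k x| <= C1 * E * (h + k) /\
    `|dq b h x - dq b k x| <= C1 * E * (h + k).
  move=> hh kk; rewrite -mulrA.
  apply: (HC1 _ _ _ _ _ _ (cr_pairB (dq_cr h hh) (dq_cr k kk)) _ x); last exact: le_ball.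
  move=> y xy; have [h1 h2] := dq_near h y hh xy; have [k1 k2] := dq_near k y kk xy.
  rewrite mulrDr; split.
    rewrite [X in `|X|](_ : _ = (dq p h y - a y) - (dq p k y - a y)).
      exact: le_trans (ler_normB _ _) (lerD h1 k1).
    by rewrite -[LHS]/(dq p h y - dq p k y); ring.
  rewrite [X in `|X|](_ : _ = (dq q h y - b y) - (dq q k y - b y)).
    exact: le_trans (ler_normB _ _) (lerD h2 k2).
  by rewrite -[LHS]/(dq q h y - dq q k y); ring.
have [a2 a2P] := lim_rate eta0 (fun h k hh kk => (rate h k hh kk).1).
have [b2 b2P] := lim_rate eta0 (fun h k hh kk => (rate h k hh kk).2).
(* A bound on the difference quotients that does not depend on [h]. *)
pose M2 := C1 * M + E * eta.
have dq_bound h : 0 < h <= eta -> bounded_pair (ball x r) (dq p h) (dq q h) M2.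
  move=> hh y xy; have [h1 h2] := dq_near h y hh xy; have [a1 b1] := abM y xy.
  have hE : E * h <= E * eta by rewrite ler_wpM2l//; case/andP: hh.
  split.
    rewrite -[dq p h y](subrK (a y)) addrC (le_trans (ler_normD _ _))// lerD//.
    exact: le_trans hE.
  rewrite -[dq q h y](subrK (b y)) addrC (le_trans (ler_normD _ _))// lerD//.
  exact: le_trans hE.
have xvr v : `|v| < s -> ball x r (x + v).
  move=> vs; apply: le_ball sr _ _; rewrite -ball_normE /ball_/= opprD addrA subrr.
  by rewrite sub0r normrN.
have taylor v : `|v| < s ->
    `|a (x + v) - a x - (a2 * alpha v - b2 * beta v)| <= C2 * M2 * `|v| ^+ 2 /\
    `|b (x + v) - b x - (b2 * alpha v + a2 * beta v)| <= C2 * M2 * `|v| ^+ 2.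
  move=> vs.
  (* The rate at which the Taylor remainder of the quotients approaches that of [a] and [b]: values
     at [x + v] and [x], then the two derivative terms. *)
  pose Ev := E + E + (C1 * E * `|alpha v| + C1 * E * `|beta v|).
  have near h : 0 < h <= eta ->
     `|a (x + v) - a x - (a2 * alpha v - b2 * beta v)| <= C2 * M2 * `|v| ^+ 2 + Ev * h /\
     `|b (x + v) - b x - (b2 * alpha v + a2 * beta v)| <= C2 * M2 * `|v| ^+ 2 + Ev * h.
    move=> hh.
    have [t1 t2] := HC2 _ _ _ _ _ _ _ _ (dq_cr h hh) (dq_bound h hh) (@subset_refl _ _) (ltW vs).
    have [n1 n2] := dq_near h _ hh xr; have [n3 n4] := dq_near h _ hh (xvr v vs).
    have ra : `|(dq a h x - a2) * alpha v| <= C1 * E * h * `|alpha v|.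
      by rewrite normrM ler_wpM2r// a2P.
    have ra' : `|(dq a h x - a2) * beta v| <= C1 * E * h * `|beta v|.
      by rewrite normrM ler_wpM2r// a2P.
    have rb : `|(dq b h x - b2) * beta v| <= C1 * E * h * `|beta v|.
      by rewrite normrM ler_wpM2r// b2P.
    have rb' : `|(dq b h x - b2) * alpha v| <= C1 * E * h * `|alpha v|.
      by rewrite normrM ler_wpM2r// b2P.
    have EvE : Ev * h = E * h + E * h + (C1 * E * h * `|alpha v| + C1 * E * h * `|beta v|).
      by rewrite /Ev; ring.
    rewrite EvE.
    split.
      rewrite [X in `|X|](_ : _ =
        (dq p h (x + v) - dq p h x - (dq a h x * alpha v - dq b h x * beta v)) -
        (dq p h (x + v) - a (x + v)) + (dq p h x - a x) +
        ((dq a h x - a2) * alpha v - (dq b h x - b2) * beta v)); last by ring.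
      exact: ler_norm_sum5.
    rewrite [X in `|X|](_ : _ =
      (dq q h (x + v) - dq q h x - (dq b h x * alpha v + dq a h x * beta v)) -
      (dq q h (x + v) - b (x + v)) + (dq q h x - b x) +
      ((dq b h x - b2) * alpha v - - ((dq a h x - a2) * beta v))); last by ring.
    by apply: ler_norm_sum5; rewrite // normrN.
  by split; apply: (@ler_rate _ _ _ Ev _ eta0) => h /near[].
exists (a2, b2) => /=; split.
  have -> : (fun v => a2 * alpha v - b2 * beta v) = (fun v => a2 * alpha v + (- b2) * beta v).
    by apply/funext => v; rewrite mulNr.
  by apply: (@is_diff_comb _ _ _ _ (C2 * M2) s) => // v vs; rewrite mulNr; have [] := taylor v vs.
by apply: (@is_diff_comb _ _ _ _ (C2 * M2) s) => // v vs; have [] := taylor v vs.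
Qed.

(** The pair is differentiable, hence continuous and bounded near each point, so the local result
    applies there; choice collects the pointwise derivatives. *)
Lemma cr_pair_derivative (U : set V) p q a b :
  open U -> cr U p q a b -> exists a' b', cr U a b a' b'.
Proof.
move=> openU pq.
suff /choice[ab abP] : forall x, exists ab : R * R, U x ->
    is_diff x a (fun v => ab.1 * alpha v - ab.2 * beta v) /\
    is_diff x b (fun v => ab.2 * alpha v + ab.1 * beta v).
  by exists (fun x => (ab x).1), (fun x => (ab x).2) => x /abP.
move=> x; have [Ux|nUx] := pselect (U x); last by exists (0, 0).
have [[dp _] [dq _]] := pq x Ux.
have cp := differentiable_continuous dp; have cq := differentiable_continuous dq.
pose M := Num.max (`|p x| + 1) (`|q x| + 1).
have nD : \forall y \near x, U y /\ `|p y| <= M /\ `|q y| <= M.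
  have nU : \forall y \near x, U y by exact: open_nbhs_nbhs.
  have bnd (f : V -> R) : f @ x --> f x -> \forall y \near x, `|f y| <= `|f x| + 1.
    by move=> /cvgr_norm_le; apply; rewrite ltrDl.
  near=> y; split; first by near: y.
  split; rewrite /M le_max; apply/orP; [left|right]; near: y; exact: bnd.
have /nbhs_ballP[r /= r0 rD] := nD.
have s0 : 0 < r / 6 by rewrite divr_gt0.
have pqD : cr (ball x r) p q a b by apply: cr_pairS pq => y /rD[].
have pqM : bounded_pair (ball x r) p q M by move=> y /rD[_].
have [|ab abP] := cr_pair_derivative_at (x := x) s0 pqD pqM.
  by apply: le_ball; lra.
by exists ab.
Unshelve. all: by end_near. Qed.

End CauchyRiemannPair.

(** * Linear combinations of holomorphic pairs on R^3 *)

Definition dot3 (R : realType) (w : 'I_3 -> R) (v : 'cV[R]_3) : R^o :=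
  \sum_i w i * v i 0.

Lemma dot3_linear (R : realType) (w : 'I_3 -> R) : linear (dot3 w).
Proof.
move=> k u v; rewrite /dot3 scaler_sumr -big_split; apply: eq_bigr => i _ /=.
by rewrite !mxE /GRing.scale/=; ring.
Qed.

HB.instance Definition _ (R : realType) (w : 'I_3 -> R) :=
  GRing.isLinear.Build R 'cV[R]_3 R^o _ (dot3 w) (dot3_linear w).

Lemma I3_ind (P : 'I_3 -> Prop) : P 0 -> P 1 -> P 2 -> forall i, P i.
Proof.
move=> P0 P1 P2 [[|[|[|//]]] i3].
- by rewrite (_ : Ordinal _ = 0)//; exact: val_inj.
- by rewrite (_ : Ordinal _ = 1)//; exact: val_inj.
- by rewrite (_ : Ordinal _ = 2)//; exact: val_inj.
Qed.

Lemma sum3 (R : realType) (f : 'I_3 -> R) : \sum_i f i = f 0 + f 1 + f 2.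
Proof.
rewrite !big_ord_recl big_ord0 addr0 addrA.
by congr (_ + f _ + f _); exact: val_inj.
Qed.

Lemma dot3E (R : realType) (w : 'I_3 -> R) (v : 'cV[R]_3) :
  dot3 w v = w 0 * v 0 0 + w 1 * v 1 0 + w 2 * v 2 0.
Proof. exact: sum3. Qed.

Lemma cyc_mulE (R : realType) (u v : 'cV[R]_3) :
  cyc_mul u v = col3
    (u 0 0 * v 0 0 + u 1 0 * v 2 0 + u 2 0 * v 1 0)
    (u 0 0 * v 1 0 + u 1 0 * v 0 0 + u 2 0 * v 2 0)
    (u 0 0 * v 2 0 + u 1 0 * v 1 0 + u 2 0 * v 0 0).
Proof.
apply/colP; apply: I3_ind; rewrite !mxE sum3 /=;
  by congr (_ * v _ _ + _ * v _ _ + _ * v _ _); exact: val_inj.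
Qed.

Lemma matA_mulE (R : realType) (v : 'cV[R]_3) :
  matA R *m v = col3 (- v 0 0 - v 1 0) (v 0 0 - v 2 0) (v 1 0 + v 2 0).
Proof. by apply/colP; apply: I3_ind; rewrite !mxE sum3 !mxE /=; ring. Qed.

Lemma col3E (R : realType) (a b c : R) :
  (col3 a b c 0 0 = a) * (col3 a b c 1 0 = b) * (col3 a b c 2 0 = c).
Proof. by rewrite !mxE. Qed.

Lemma dot3_basis (R : realType) (w : 'I_3 -> R) i : dot3 w (Defs.basis R i) = w i.
Proof.
rewrite /dot3 (bigD1 i)//= big1 ?addr0 => [|j ji]; first by rewrite mxE !eqxx mulr1.
by rewrite mxE (negbTE ji) mulr0.
Qed.

Lemma dot3_bound (R : realType) (w : 'I_3 -> R) (v : 'cV[R]_3) :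
  `|dot3 w v| <= (\sum_i `|w i|) * `|v|.
Proof.
rewrite mulr_suml (le_trans (ler_norm_sum _ _ _))// ler_sum// => i _.
rewrite normrM ler_wpM2l// [leRHS]mx_normrE.
exact: (le_bigmax _ (fun ij => `|v ij.1 ij.2|) (i, 0)).
Qed.

Lemma dot3_continuous (R : realType) (w : 'I_3 -> R) : continuous (dot3 w).
Proof.
apply: bounded_linear_continuous; apply/linear_boundedP.
exists (\sum_i `|w i|); split; first exact: num_real.
by move=> M KM v; rewrite (le_trans (dot3_bound _ _))// ler_wpM2r// ltW.
Qed.

Lemma is_diff_dot3 (R : realType) (w : 'I_3 -> R) (x : 'cV[R]_3) :
  is_diff x (dot3 w) (dot3 w).
Proof.
have cw := @dot3_continuous R w.
exact: DiffDef (linear_differentiable _ cw) (diff_lin _ cw).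
Qed.

Lemma is_diff_dot3_comp (R : realType) (F : 'cV[R]_3 -> 'cV[R]_3)
    (w : 'I_3 -> R) (x : 'cV[R]_3) :
  differentiable F x ->
  is_diff x (fun q => dot3 w (F q)) (fun v => dot3 w ('d F x v)).
Proof.
by move=> dF; exact: (is_diff_comp (differentiableP dF) (is_diff_dot3 w (F x))).
Qed.

(** Each coordinate of the affine map is a form [dot3] plus a constant, whose differential is
    known. *)
Lemma diff_matA (R : realType) (k x v : 'cV[R]_3) :
  differentiable (fun q => matA R *m q + k) x ->
  'd (fun q => matA R *m q + k) x v = matA R *m v.
Proof.
move=> dphi; apply/colP => i.
pose w j : R := (j == i)%:R.
have wE u : dot3 w u = u i 0.
  rewrite /dot3 (bigD1 i)//= big1 ?addr0 => [|j ji]; last first.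
    by rewrite /w (negbTE ji) mul0r.
  by rewrite /w eqxx mul1r.
have [_ dE] := is_diff_dot3_comp w dphi.
have [_ dE'] : is_diff x (fun q => dot3 w (matA R *m q + k)) (dot3 (matA R i)).
  have -> : (fun q => dot3 w (matA R *m q + k)) = dot3 (matA R i) + cst (k i 0).
    by apply/funext => q; rewrite wE !fctE !mxE.
  apply: (is_diff_eq (is_diffD (is_diff_dot3 _ x) (is_diff_cst _ x))).
  by apply/funext => u; rewrite fctE addr0.
by have := congr1 (@^~ v) (etrans (esym dE) dE'); rewrite /= wE => ->; rewrite mxE.
Qed.

Section HarmonicCombinations.
Context (R : realType) (alpha beta : 'I_3 -> R) (U : set 'cV[R]_3)
  (openU : open U).

Lemma comb_is_diff (p q a b : 'cV[R]_3 -> R) (c d : R) (x : 'cV[R]_3) :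
  cr_pair (dot3 alpha) (dot3 beta) U p q a b -> U x ->
  is_diff x (fun y => c * p y + d * q y) (fun v =>
    c * (a x * dot3 alpha v - b x * dot3 beta v) +
    d * (b x * dot3 alpha v + a x * dot3 beta v)).
Proof.
move=> pq Ux; have [dp dq] := pq x Ux.
exact: (is_diffD (is_diffZ c dp) (is_diffZ d dq)).
Qed.

Lemma comb_partial (p q a b g : 'cV[R]_3 -> R) (c d : R) (i : 'I_3) x :
  cr_pair (dot3 alpha) (dot3 beta) U p q a b ->
  (forall y, U y -> g y = c * p y + d * q y) -> U x ->
  derivable g x (Defs.basis R i) /\
  partial i g x = (c * alpha i + d * beta i) * a x + (d * alpha i - c * beta i) * b x.
Proof.
move=> pq gE Ux.
have ge : \forall y \near x, c * p y + d * q y = g y.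
  have : \forall y \near x, U y by exact: open_nbhs_nbhs.
  by apply: filterS => y /gE.
have [df dfE] := comb_is_diff c d pq Ux.
split; first by apply: near_eq_derivable ge _; exact: diff_derivable.
rewrite /partial -(near_eq_derive _ ge) deriveE// dfE !dot3_basis; ring.
Qed.

Lemma comb_C1 (p q a b a' b' g : 'cV[R]_3 -> R) (c d : R) :
  cr_pair (dot3 alpha) (dot3 beta) U p q a b ->
  cr_pair (dot3 alpha) (dot3 beta) U a b a' b' ->
  (forall y, U y -> g y = c * p y + d * q y) -> C1_on U g.
Proof.
move=> pq ab gE i x Ux; split; first by have [] := comb_partial i pq gE Ux.
have [df _] := comb_is_diff (c * alpha i + d * beta i) (d * alpha i - c * beta i) ab Ux.
pose G x := (c * alpha i + d * beta i) * a x + (d * alpha i - c * beta i) * b x.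
have GE y : U y -> G y = partial i g y.
  by move=> Uy; have [_ ->] := comb_partial i pq gE Uy.
have ne : \forall y \near x, G y = partial i g y.
  have : \forall y \near x, U y by exact: open_nbhs_nbhs.
  by apply: filterS => y /GE.
have cG : G y @[y --> x] --> G x by exact: (differentiable_continuous df).
by rewrite GE// in cG; exact: cvg_trans (near_eq_cvg ne) cG.
Qed.

(** Second partials are combinations of [a', b']; their continuity comes from the third pair, which
    makes [a', b'] differentiable. *)
Lemma comb_C2 (p q a b a' b' a'' b'' g : 'cV[R]_3 -> R) (c d : R) :
  cr_pair (dot3 alpha) (dot3 beta) U p q a b ->
  cr_pair (dot3 alpha) (dot3 beta) U a b a' b' ->
  cr_pair (dot3 alpha) (dot3 beta) U a' b' a'' b'' ->
  (forall y, U y -> g y = c * p y + d * q y) -> C2_on U g.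
Proof.
move=> pq ab ab' gE; split; first exact: comb_C1 pq ab gE.
move=> i; apply: (comb_C1 (c := c * alpha i + d * beta i)
  (d := d * alpha i - c * beta i) ab ab') => y Uy.
by have [_ ->] := comb_partial i pq gE Uy.
Qed.

(* The two equations say that the complex coordinate [alpha + i beta] is
   conformal. *)
Lemma comb_laplacian (p q a b a' b' g : 'cV[R]_3 -> R) (c d : R) x :
  cr_pair (dot3 alpha) (dot3 beta) U p q a b ->
  cr_pair (dot3 alpha) (dot3 beta) U a b a' b' ->
  (forall y, U y -> g y = c * p y + d * q y) ->
  alpha 0 ^+ 2 + alpha 1 ^+ 2 + alpha 2 ^+ 2 =
    beta 0 ^+ 2 + beta 1 ^+ 2 + beta 2 ^+ 2 ->
  alpha 0 * beta 0 + alpha 1 * beta 1 + alpha 2 * beta 2 = 0 ->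
  U x -> laplacian g x = 0.
Proof.
move=> pq ab gE conf orth Ux.
have pE i : partial i (partial i g) x =
    (c * alpha i + d * beta i) * (a' x * alpha i - b' x * beta i) +
    (d * alpha i - c * beta i) * (b' x * alpha i + a' x * beta i).
  have [|_ ->] := @comb_partial a b a' b' (partial i g)
      (c * alpha i + d * beta i) (d * alpha i - c * beta i) i x ab _ Ux.
    by move=> y Uy; have [_ ->] := comb_partial i pq gE Uy.
  by ring.
rewrite /laplacian /dx /dy /dz !pE.
transitivity ((c * a' x + d * b' x) *
    ((alpha 0 ^+ 2 + alpha 1 ^+ 2 + alpha 2 ^+ 2) -
     (beta 0 ^+ 2 + beta 1 ^+ 2 + beta 2 ^+ 2)) +
    2 * (d * a' x - c * b' x) *
    (alpha 0 * beta 0 + alpha 1 * beta 1 + alpha 2 * beta 2)); first by ring.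
by rewrite conf orth subrr !mulr0 addr0.
Qed.

End HarmonicCombinations.

(** * The complex factor of the cyclic algebra in coordinates *)

Definition triple (R : realType) (a b c : R) (i : 'I_3) : R := nth 0 [:: a; b; c] i.

Theorem theorem3p1 (R : realType) (k : 'cV[R]_3) (U : set 'cV[R]_3)
    (F : 'cV[R]_3 -> 'cV[R]_3)
    (openU : open U)
    (dF : phiA_differentiable U (fun q => matA R *m q + k) F)
    (CR : let F1 := component F 0 in
          let F2 := component F 1 in
          let F3 := component F 2 in
          forall q, U q ->
          [/\ dx F1 q - dy F1 q - dx F2 q + dy F3 q = 0,
              - dx F1 q + dy F2 q + dx F3 q - dy F3 q = 0,
              - dz F1 q - dx F2 q + dx F3 q + dz F3 q = 0
            & dx F1 q + dz F1 q - dz F2 q - dx F3 q = 0]) :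
  let V := fun q => Vmap (F q) in
  (forall q, U q ->
     [/\ (Vmap (R := R) @` @nodal_plane R) (V q),
         div3 V q = 0
       & curl3 V q = 0]) /\
  harmonic_field U V.
Proof.
move=> V; case: dF => dphi [dF [F' F'E]].
pose r : R := Num.sqrt 3.
have rr : r * r = 3 by rewrite -expr2 sqr_sqrtr.
have r0 : r != 0 by apply/eqP => r0; move: rr; rewrite r0 mul0r; lra.
(* [re] and [im] are the real and imaginary parts of the character sending [e_2] to the cube root of
   unity [(-1 + i r) / 2]; [alpha] and [beta] are their compositions with [matA]. *)
pose alpha := triple (- (3 / 2) : R) (- (3 / 2)) 0.
pose beta := triple (r / 2) (- (r / 2)) (- r).
pose re := triple (1 : R) (- (1 / 2)) (- (1 / 2)).
pose im := triple 0 (r / 2) (- (r / 2)).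
pose p x := dot3 re (F x); pose q x := dot3 im (F x).
pose a x := dot3 re (F' x); pose b x := dot3 im (F' x).
have FE x v : U x -> 'd F x v = cyc_mul (F' x) (matA R *m v).
  by move=> Ux; rewrite F'E//; congr (cyc_mul _ _); apply/diff_matA/dphi.
(* The character is multiplicative, so it turns [F' * (A v)] into the complex product of [a + i b]
   and [alpha + i beta]. *)
have pq : cr_pair (dot3 alpha) (dot3 beta) U p q a b.
  move=> x Ux; split.
    apply: (is_diff_eq (is_diff_dot3_comp re (dF x Ux))); apply/funext => v.
    rewrite FE// cyc_mulE matA_mulE !dot3E !col3E /a /b !dot3E /re /im /alpha /beta /triple /=.
    move: (F' x 0 0) (F' x 1 0) (F' x 2 0) (v 0 0) (v 1 0) (v 2 0) => u0 u1 u2 v0 v1 v2.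
    transitivity ((u0 - (u1 + u2) / 2) * (- (3 / 2) * (v0 + v1)) -
        3 / 4 * ((u1 - u2) * (v0 - v1 - 2 * v2))); first by field.
    by rewrite -rr; field.
  apply: (is_diff_eq (is_diff_dot3_comp im (dF x Ux))); apply/funext => v.
  rewrite FE// cyc_mulE matA_mulE !dot3E !col3E /a /b !dot3E /re /im /alpha /beta /triple /=.
  move: (F' x 0 0) (F' x 1 0) (F' x 2 0) (v 0 0) (v 1 0) (v 2 0) => u0 u1 u2 v0 v1 v2.
  by field.
(* The coefficient vectors of [alpha] and [beta], orthogonal and of squared norm [9 / 2], divided by
   that norm squared: a dual pair. *)
pose ea : 'cV[R]_3 := col3 (- (1 / 3)) (- (1 / 3)) 0.
pose eb : 'cV[R]_3 := col3 (r / 9) (- (r / 9)) (- (2 * r / 9)).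
have alphaE u v : dot3 alpha (u *: ea + v *: eb) = u.
  by rewrite dot3E !mxE /alpha /triple /=; field.
have betaE u v : dot3 beta (u *: ea + v *: eb) = v.
  rewrite dot3E !mxE /beta /triple /=.
  by transitivity (v * (r * r) / 3); [field|rewrite rr; field].
pose K := \sum_i `|alpha i| + \sum_i `|beta i|.
have alphaK v : `|dot3 alpha v| <= K * `|v|.
  by rewrite (le_trans (dot3_bound _ _))// ler_wpM2r// lerDl sumr_ge0.
have betaK v : `|dot3 beta v| <= K * `|v|.
  by rewrite (le_trans (dot3_bound _ _))// ler_wpM2r// lerDr sumr_ge0.
have [a' [b' ab]] := cr_pair_derivative alphaE betaE alphaK betaK openU pq.
have [a'' [b'' ab']] := cr_pair_derivative alphaE betaE alphaK betaK openU ab.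
(* Obtained by solving [p = F^1 - (F^2 + F^3) / 2] and [q = r (F^2 - F^3) / 2] for the differences
   of components of [F]. *)
pose c := triple 0 (-1 : R) (-1).
pose d := triple (- (2 * r / 3)) (- (r / 3)) (r / 3).
have VE i y : U y -> component V i y = c i * p y + d i * q y.
  move=> _; rewrite /component /V /Vmap /p /q !dot3E; move: (F y 0 0) (F y 1 0) (F y 2 0) => f0 f1 f2.
  move: i; apply: I3_ind; rewrite col3E /re /im /c /d /triple /=.
  - by transitivity (- ((r * r) / 3 * (f1 - f2))); [rewrite rr; field|field].
  - by transitivity (- (f0 - (f1 + f2) / 2) - (r * r) / 6 * (f1 - f2)); [rewrite rr; field|field].
  - by transitivity (- (f0 - (f1 + f2) / 2) + (r * r) / 6 * (f1 - f2)); [rewrite rr; field|field].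
(* The integer parts of [beta = bb * r / 2] and [d = dd * r / 3]. With [r * r = 3] used once in
   [dV], divergence and curl become identities that hold for [r] as an indeterminate. *)
pose bb := triple (1 : R) (-1) (-2).
pose dd := triple (-2 : R) (-1) 1.
have dV i j x : U x -> partial i (component V j) x =
    (c j * alpha i + dd j * bb i / 2) * a x +
    r * (dd j * alpha i / 3 - c j * bb i / 2) * b x.
  move=> Ux; have [_ ->] := comb_partial openU i pq (VE j) Ux.
  have -> : beta i = bb i * r / 2 by move: i; apply: I3_ind; rewrite /beta /bb /triple /=; field.
  have -> : d j = dd j * r / 3 by move: j; apply: I3_ind; rewrite /d /dd /triple /=; field.
  transitivity ((c j * alpha i + dd j * bb i / 6 * (r * r)) * a x +
    r * (dd j * alpha i / 3 - c j * bb i / 2) * b x); first by field.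
  by rewrite rr; field.
split=> [x Ux|].
  split.
  (* [Vmap] kills multiples of [e + e_2 + e_3], so subtracting the mean moves [F x] into the nodal
     plane without changing its image. *)
  - pose m := (F x 0 0 + F x 1 0 + F x 2 0) / 3.
    exists (F x - col3 m m m); first by rewrite /nodal_plane/= !mxE /= /m; field.
    by apply/colP; apply: I3_ind; rewrite /V /Vmap !mxE /=; ring.
  - by rewrite /div3 /dx /dy /dz !dV// /c /dd /bb /alpha /triple /=; field.
  - rewrite /curl3 /dx /dy /dz !dV// /c /dd /bb /alpha /triple /=.
    by apply/colP; apply: I3_ind; rewrite col3E mxE; field.
split=> [i|x Ux]; first exact: (comb_C2 openU pq ab ab' (VE i)).
apply/colP => i; rewrite !mxE; apply: (comb_laplacian openU pq ab (VE i)) => //.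
  rewrite /alpha /beta /triple /=.
  by transitivity (3 * (3 / 2) : R); [field|rewrite -[X in X * _]rr; field].
by rewrite /alpha /beta /triple /=; field.
Qed.
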